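(* Let $\overline{G}$ and $\overline{G'}$ be directed graphs. If $\overline{G}$ is intrinsically linked as a digraph and $\overline{G'}$ is obtained from $\overline{G}$ by a consistent vertex expansion, then $\overline{G'}$ is intrinsically linked as a digraph. Equivalently, if $\overline{G'}$ has a linkless embedding and $\overline{G}$ is obtained from $\overline{G'}$ by a consistent edge contraction, then $\overline{G}$ has a linkless embedding; that is, the property of having a linkless embedding is closed under consistent edge contraction.
   Context: All digraphs are finite and embeddings are (tame) embeddings in $\mathbb{R}^3$. A cycle in a digraph is consistently oriented if it is a directed cycle (all of its edges are oriented in the same direction around the cycle; a pair of oppositely directed edges $uv$, $vu$ is a consistently oriented 2-cycle). A consistently oriented link in an embedding of a digraph is a link whose components are the images of two or more pairwise disjoint consistently oriented cycles. A link is non-split if no embedded 2-sphere in its complement separates some of its components from the others. A digraph is intrinsically linked (as a digraph) if every embedding of it in $\mathbb{R}^3$ contains a non-split consistently oriented link. A linkless embedding of a digraph is an embedding containing no non-split consistently oriented link. Let $\overline{G'}$ be a digraph obtained from $\overline{G}$ by splitting a vertex $v$ into two vertices $v_1$ and $v_2$ (each edge incident to $v$ becomes an edge, with the same direction, incident to exactly one of $v_1$, $v_2$) and adding an edge $e$ directed from $v_1$ to $v_2$. If $v_1$ is a sink in $\overline{G'}\setminus e$ (no edge of $\overline{G'} \setminus e$ leaves $v_1$) or $v_2$ is a source in $\overline{G'}\setminus e$ (no edge of $\overline{G'}\setminus e$ enters $v_2$), then $\overline{G'}$ is said to be obtained from $\overline{G}$ by a consistent vertex expansion. If $\overline{G}$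 is obtained from $\overline{G'}$ by contracting such an edge $e$, then $\overline{G}$ is said to be obtained from $\overline{G'}$ by a consistent edge contraction. *)

(* Defs.v *)
From HB Require Import structures.
From mathcomp Require Import all_boot all_order all_algebra.
From mathcomp Require Import all_classical all_reals all_analysis.

Set Implicit Arguments.
Unset Strict Implicit.
Unset Printing Implicit Defensive.

Import Order.TTheory GRing.Theory Num.Theory.
Import numFieldNormedType.Exports.

Local Open Scope classical_set_scope.
Local Open Scope ring_scope.

(* Parallel edges and loops are allowed: the contraction of an edge keeps every
   other edge, so it may create both. *)
Record digraph := Digraph {
  vertex : finType;
  edge : finType;
  src : edge -> vertex;
  tgt : edge -> vertex }.

Arguments src {d} _.
Arguments tgt {d} _.

Definition incident (G : digraph) (v : vertex G) (f : edge G) : bool :=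
  (src f == v) || (tgt f == v).

(* A directed cycle is given by its cyclic sequence of edges; each of its
   vertices is the source of exactly one of these edges. *)
Definition directed_cycle (G : digraph) (c : seq (edge G)) : bool :=
  [&& c != [::], cycle (fun e f => tgt e == src f) c & uniq (map src c)].

Definition disjoint_cycles (G : digraph) (c d : seq (edge G)) : bool :=
  [disjoint map src c & map src d].

(* [e] joins two distinct vertices, and deleting [e] makes its tail a sink or
   its head a source. *)
Definition consistent_edge (G : digraph) (e : edge G) : Prop :=
  src e != tgt e /\
  ((forall f : edge G, f != e -> src f != src e) \/
   (forall f : edge G, f != e -> tgt f != tgt e)).

(* [G] is isomorphic to [G' / e]: [pi] is the quotient map on vertices, and
   [iota] identifies the edges of [G] with the edges of [G'] other than [e]. *)
Definition contraction (G' : digraph) (e : edge G') (G : digraph)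
    (pi : vertex G' -> vertex G) (iota : edge G -> edge G') : Prop :=
  [/\ forall v, exists x, pi x = v,
      forall x y, (pi x == pi y) =
        (x == y) || (x \in pred2 (src e) (tgt e)) &&
                    (y \in pred2 (src e) (tgt e)),
      injective iota,
      forall f', f' != e <-> exists f, iota f = f' &
      forall f, pi (src (iota f)) = src f /\ pi (tgt (iota f)) = tgt f].

Definition consistent_edge_contraction (G' G : digraph) : Prop :=
  exists (e : edge G') (pi : vertex G' -> vertex G) (iota : edge G -> edge G'),
    consistent_edge e /\ contraction e pi iota.

(* [v] splits into [v1] and [v2], joined by the new edge [e]. *)
Definition vertex_splitting (G : digraph) (v : vertex G) (G' : digraph)
    (v1 v2 : vertex G') (e : edge G')
    (pi : vertex G' -> vertex G) (iota : edge G -> edge G') : Prop :=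
  [/\ [/\ v1 != v2, src e = v1, tgt e = v2, pi v1 = v & pi v2 = v],
      contraction e pi iota &
      forall f, incident v f -> incident v1 (iota f) (+) incident v2 (iota f)].

Definition consistent_vertex_expansion (G G' : digraph) : Prop :=
  exists (v : vertex G) (v1 v2 : vertex G') (e : edge G')
         (pi : vertex G' -> vertex G) (iota : edge G -> edge G'),
    vertex_splitting v v1 v2 e pi iota /\ consistent_edge e.

Section Space.
Variable R : realType.

Definition homeomorphism (h : 'rV[R]_3 -> 'rV[R]_3) : Prop :=
  continuous h /\
  exists2 g : 'rV[R]_3 -> 'rV[R]_3, continuous g & cancel h g /\ cancel g h.

Definition piecewise_linear (g : R -> 'rV[R]_3) : Prop :=
  exists2 s : seq R, itv_partition 0 1 s &
    forall i, (i < size s)%N -> exists a b : 'rV[R]_3,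
      forall t : R, t \in `[nth 0 (0 :: s) i, nth 0 s i] -> g t = a + t *: b.

(* The data of an injective continuous map from the (compact) geometric
   realization of [G] to R^3: [p] places the vertices, and [gamma e],
   restricted to [0, 1], is the arc (a closed curve if [e] is a loop) from
   [p (src e)] to [p (tgt e)]. *)
Definition graph_embedding (G : digraph) (p : vertex G -> 'rV[R]_3)
    (gamma : edge G -> R -> 'rV[R]_3) : Prop :=
  [/\ injective p,
      forall e, {within `[0, 1], continuous (gamma e)},
      forall e, gamma e 0 = p (src e) /\ gamma e 1 = p (tgt e),
      forall e f (s t : R), s \in `]0, 1[ -> t \in `]0, 1[ ->
        gamma e s = gamma f t -> e = f /\ s = t &
      forall e (s : R) v, s \in `]0, 1[ -> gamma e s <> p v].

(* Tame: equivalent to a piecewise linear embedding under a homeomorphism of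
   the ambient space. *)
Definition tame_embedding (G : digraph) (p : vertex G -> 'rV[R]_3)
    (gamma : edge G -> R -> 'rV[R]_3) : Prop :=
  graph_embedding p gamma /\
  exists2 h, homeomorphism h & forall e, piecewise_linear (h \o gamma e).

Definition unit_sphere : set 'rV[R]_3 := [set x | \sum_i x 0 i ^+ 2 = 1].

Definition embedded_sphere (S : set 'rV[R]_3) : Prop :=
  exists sigma : 'rV[R]_3 -> 'rV[R]_3,
    [/\ {within unit_sphere, continuous sigma}, set_inj unit_sphere sigma &
        S = sigma @` unit_sphere].

Definition split_link (n : nat) (K : 'I_n -> set 'rV[R]_3) : Prop :=
  exists S : set 'rV[R]_3,
    [/\ embedded_sphere S, forall i, K i `&` S = set0 &
      exists A : {set 'I_n},
        [/\ A != finset.set0, A != [set: 'I_n]%SET &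
          forall i j, i \in A -> j \notin A ->
            forall x y, K i x -> K j y -> ~ connected_component (~` S) x y]].

Definition cycle_image (G : digraph) (gamma : edge G -> R -> 'rV[R]_3)
    (c : seq (edge G)) : set 'rV[R]_3 :=
  [set x | exists2 e, e \in c & (gamma e @` `[0, 1]) x].

Definition contains_nonsplit_consistent_link (G : digraph)
    (gamma : edge G -> R -> 'rV[R]_3) : Prop :=
  exists (n : nat) (c : 'I_n -> seq (edge G)),
    [/\ (2 <= n)%N, forall i, directed_cycle (c i),
        forall i j, i != j -> disjoint_cycles (c i) (c j) &
        ~ split_link (fun i => cycle_image gamma (c i))].

Definition intrinsically_linked (G : digraph) : Prop :=
  forall p gamma, @tame_embedding G p gamma ->
    contains_nonsplit_consistent_link gamma.

Definition has_linkless_embedding (G : digraph) : Prop :=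
  exists p gamma, @tame_embedding G p gamma /\
    ~ contains_nonsplit_consistent_link gamma.

End Space.

(* Main.v *)
Require Import Defs.
From mathcomp Require Import all_boot all_order all_algebra.
From mathcomp Require Import all_classical all_reals all_analysis.
From mathcomp Require Import ring lra.

(* Let [x] be the end of the consistent edge [e] that is a sink or a source
   without [e]: a directed cycle through [x] must use [e].  Straighten the
   ambient space so that the embedding is piecewise linear, and collapse the arc
   of [e] to its other end by a proper surjection of R^3 that is injective off
   the arc.  The collapse is done one segment of the arc at a time, starting
   from [x]; each step moves points only in a thin spindle around the segment
   and in a small neighbourhood of its end near [x], so it is the identity on
   every arc that does not end at [x].

   A link of directed cycles of [G] lifts to one of [G'].  If the lift uses [e],
   a sphere splitting it misses the arc of [e], and its image under the collapse
   is a splitting sphere for the link of [G], since preimages of connected sets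
   under the collapse are connected.  If the lift avoids [e], it avoids [x], the
   collapse fixes it pointwise and the same sphere works. *)

Set Implicit Arguments.
Unset Strict Implicit.
Unset Printing Implicit Defensive.

Import Order.TTheory GRing.Theory Num.Theory.
Import numFieldNormedType.Exports.

Local Open Scope classical_set_scope.
Local Open Scope ring_scope.

(** * Collapsing maps and split links *)

Section Collapse.
Variable R : realType.
Notation V := 'rV[R]_3.

(** These are the properties of the quotient map that shrinks [E] to a point. [E] may be empty, so
    homeomorphisms qualify. *)
Definition collapse (q : V -> V) (E : set V) : Prop :=
  [/\ continuous q, forall F, closed F -> closed (q @` F),
      forall y, exists x, q x = y, connected E &
      forall x y, q x = q y <-> x = y \/ E x /\ E y].

(** A nonempty relatively clopen part [B] of the preimage contains [E] as soon as it meets it,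
    because [E] is connected. So [B] is a union of fibres, and its image is clopen in [C]. *)
Lemma collapse_preimage_connected (q : V -> V) (E C : set V) :
  collapse q E -> connected C -> connected (q @^-1` C).
Proof.
move=> [cq clq sq cE qE] cC B [x0 Bx0] [U oU BU] [F cF BF].
have sat x y : q x = q y -> C (q x) -> B x -> B y.
  move=> /[dup] qxy /qE[<-//|[Ex Ey]] Cqx Bx.
  have EC z : E z -> C (q z).
    by move=> Ez; rewrite (_ : q z = q x)//; apply/qE; right.
  have : E `&` B = E.
    apply: cE; first by exists x.
    - exists U => //; apply/seteqP; split=> z [Ez].
        by rewrite BU => -[_ Uz].
      by move=> Uz; split=> //; rewrite BU; split=> //; exact: EC.
    - exists F => //; apply/seteqP; split=> z [Ez].
        by rewrite BF => -[_ Fz].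
      by move=> Fz; split=> //; rewrite BF; split=> //; exact: EC.
  by move=> EB; move: Ey; rewrite -EB => -[].
have BC z : B z -> C (q z) by rewrite BU => -[].
have qB : q @` B = C.
  apply: cC; first by exists (q x0), x0.
  - exists (~` (q @` ~` U)); first by apply: closed_openC; apply: clq; exact: open_closedC.
    apply/seteqP; split=> [_ [z Bz <-]|y [Cy nUy]].
      split; first exact: BC.
      move=> [z' nUz' qz]; apply: nUz'.
      have : B z' by apply: (sat z) => //; apply: BC.
      by rewrite BU => -[].
    have [z qz] := sq y; exists z => //; rewrite BU; split; first by rewrite /= qz.
    by apply: contrapT => nUz; apply: nUy; exists z.
  - exists (q @` F); first exact: clq.
    apply/seteqP; split=> [_ [z Bz <-]|y [Cy [z Fz qz]]].
      split; first exact: BC.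
      by exists z => //; move: Bz; rewrite BF => -[].
    by exists z => //; rewrite BF; split=> //; rewrite /= qz.
apply/seteqP; split=> [z /BC //|z /= Cqz].
have : (q @` B) (q z) by rewrite qB.
by move=> [z' Bz' qz]; apply: (sat z') => //; rewrite qz.
Qed.

(** The splitting sphere misses every [K i], hence [E]. So [q] is injective on it, and no other
    point is sent to its image. *)
Lemma split_collapse n (K : 'I_n -> set V) (q : V -> V) (E : set V) :
  collapse q E -> E `<=` \bigcup_i K i ->
  split_link K -> split_link (fun i => q @` K i).
Proof.
move=> cqE EK [S [[sigma [csigma isigma Ssigma]] KS [A [A0 AT sepA]]]].
have [cq clq sq cE qE] := cqE.
have ES z : E z -> ~ S z.
  by move=> /EK[i _ Kz] Sz; have : (K i `&` S) z by []; rewrite KS.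
have qS x y : S y -> q x = q y -> x = y.
  by move=> Sy /qE[//|[_ /ES]].
exists (q @` S); split.
- exists (q \o sigma); split.
  + by apply: within_continuous_comp csigma => y _; apply: cq.
  + move=> x y xS yS /= qxy; apply: isigma => //.
    by apply: qS qxy; rewrite Ssigma; exists y => //; apply: set_mem.
  + by rewrite Ssigma image_comp.
- move=> i; apply/seteqP; split=> // _ [[x Kx <-] [y Sy qyx]].
  have xy : x = y by exact: (qS _ _ Sy (esym qyx)).
  have : (K i `&` S) x by split=> //; rewrite xy.
  by rewrite KS.
exists A; split=> // i j iA jA _ _ [x Kx <-] [y Ky <-] [C [Cx CS cC] Cy].
apply: (sepA i j iA jA x y Kx Ky).
exists (q @^-1` C) => //; split=> //.
  by move=> z /= Cqz Sz; apply: (CS _ Cqz); exists z.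
exact: (collapse_preimage_connected cqE cC).
Qed.

Lemma collapse_homeomorphism (h : V -> V) : homeomorphism h -> collapse h set0.
Proof.
move=> [ch [g cg [hg gh]]]; split=> //.
- move=> F cF; rewrite (_ : h @` F = g @^-1` F).
    by apply: preimage_closed => // x _; apply: cg.
  by apply/seteqP; split=> [_ [x Fx <-] /=|y /= Fy]; [rewrite hg|exists (g y)].
- by move=> y; exists (g y).
- exact: connected0.
- by move=> x y; split=> [/(can_inj hg)|[->|[]]//]; left.
Qed.

Lemma collapse_id (a : V) : collapse id [set a].
Proof.
split=> //.
- by move=> x; exact: cvg_id.
- by move=> F cF; rewrite image_id.
- by move=> y; exists y.
- exact: connected1.
- by move=> x y; split=> [->|[//|[-> ->]]]; [left|].
Qed.

(** Here [E2] is the image of [E] under [q1]: the first map shrinks a part of [E], and the second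
    shrinks what is left. *)
Lemma collapse_comp (q1 q2 : V -> V) (E1 E2 E : set V) :
  collapse q1 E1 -> collapse q2 E2 -> connected E ->
  E = q1 @^-1` E2 -> (E1 `<=` E) -> collapse (q2 \o q1) E.
Proof.
move=> [cq1 clq1 sq1 cE1 qE1] [cq2 clq2 sq2 cE2 qE2] cE EE EE1; split=> //.
- by move=> x; apply: continuous_comp; [exact: cq1|exact: cq2].
- by move=> F /clq1/clq2; rewrite image_comp.
- move=> y; have [z <-] := sq2 y; have [x <-] := sq1 z; by exists x.
- move=> x y; rewrite EE /=; split.
    move=> /qE2[/qE1[->|[Ex Ey]]|[]]; [by left|right|by right].
    by split; [have := EE1 _ Ex|have := EE1 _ Ey]; rewrite EE.
  by move=> [->//|[? ?]]; apply/qE2; right.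
Qed.

(** Only points of [F] within [B + 1] of [y] can land within 1 of [y]; they form a compact set,
    whose image is closed. *)
Lemma closed_image_bounded_displacement (q : V -> V) (B : R) :
  continuous q -> (forall z, `|q z - z| <= B) ->
  forall F, closed F -> closed (q @` F).
Proof.
move=> cq qB F cF y cly.
pose C := F `&` closed_ball y (B + 1).
have B1 : 0 < B + 1 by rewrite ltr_wpDl// (le_trans _ (qB 0)).
have compC : compact C.
  apply: bounded_closed_compact; last first.
    by apply: closedI => //; exact: closed_ball_closed.
  exists (`|y| + (B + 1)); split=> [|M ltM x [_]]; first exact: num_real.
  rewrite closed_ballE// /closed_ball_/= => xy; apply: le_trans (ltW ltM).
  by rewrite -lerBlDl (le_trans (lerB_dist _ _))// distrC.
have : closed (q @` C).
  apply: compact_closed => //; apply: continuous_compact => //.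
  exact: continuous_subspaceT.
have sub : closure (q @` C) y -> (q @` C) y -> (q @` F) y.
  by move=> _ [x [Fx _] <-]; exists x.
move=> clC; have clCy : closure (q @` C) y; last by apply: (sub clCy); exact: clC.
move=> N yN.
have [_ [[x Fx <-] [Nqx /= bqx]]] := cly _ (filterI yN (nbhsx_ballx y 1 ltr01)).
exists (q x); split=> //; exists x => //; split=> //.
rewrite closed_ballE// /closed_ball_/=.
rewrite -(subrKA (q x)) (le_trans (ler_normD _ _))// addrC lerD ?qB//.
by move: bqx; rewrite -ball_normE /= => /ltW.
Qed.

End Collapse.

(** * Piecewise linear arcs *)

Section Germs.
Variable R : realType.
Notation V := 'rV[R]_3.

(** The filter [0^'+] leaves out 0, so [a] need not be [k 0]. *)
Definition affine_germ (W : lmodType R) (k : R -> W) : Prop :=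
  exists a b, \forall h \near 0^'+, k h = a + h *: b.

Lemma affine_germ_ext (W : lmodType R) (k k' : R -> W) :
  (\forall h \near 0^'+, k' h = k h) -> affine_germ k -> affine_germ k'.
Proof.
move=> kk' [a [b kab]]; exists a, b.
by apply: filterS2 kk' kab => h ->.
Qed.

Lemma affine_germ_cst (W : lmodType R) (c : W) : affine_germ (fun=> c).
Proof. by exists c, 0; apply: nearW => h; rewrite scaler0 addr0. Qed.

Lemma affine_germD (W : lmodType R) (k k' : R -> W) :
  affine_germ k -> affine_germ k' -> affine_germ (fun h => k h + k' h).
Proof.
move=> [a [b kab]] [a' [b' kab']]; exists (a + a'), (b + b').
by apply: filterS2 kab kab' => h -> ->; rewrite scalerDr addrACA.
Qed.

Lemma affine_germ_linear (W W' : lmodType R) (f : {linear W -> W'}) (k : R -> W) :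
  affine_germ k -> affine_germ (fun h => f (k h)).
Proof.
move=> [a [b kab]]; exists (f a), (f b).
by apply: filterS kab => h ->; rewrite linearD linearZ.
Qed.

Lemma affine_germ_sum (W : lmodType R) (I : finType) (k : I -> R -> W) :
  (forall i, affine_germ (k i)) -> affine_germ (fun h => \sum_i k i h).
Proof.
move=> /choice[a] /choice[b] kab; exists (\sum_i a i), (\sum_i b i).
apply: filterS (filter_forall _ kab) => h kh.
by rewrite scaler_sumr -big_split; apply: eq_bigr => i _; rewrite kh.
Qed.

(** The constant term decides the sign near 0, and the slope decides it when that term vanishes. *)
Lemma affine_germ_sign (k : R -> R^o) : affine_germ k ->
  (\forall h \near 0^'+, k h < 0) \/ (\forall h \near 0^'+, 0 <= k h).
Proof.
move=> [a [b kab]].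
have hb : a != 0 -> \forall h \near 0^'+, h * `|b| < `|a|.
  rewrite -normr_gt0 => a0.
  (* Adding 1 to [|b|] keeps this bound positive when the slope is 0. *)
  have ab0 : 0 < `|a| / (`|b| + 1) by rewrite divr_gt0// ltr_wpDl.
  apply: filterS2 (nbhs_right_gt 0) (nbhs_right_lt ab0) => h h0.
  rewrite ltr_pdivlMr ?ltr_wpDl// mulrDr mulr1; apply: le_lt_trans.
  by rewrite lerDl ltW.
have hpos : \forall h \near (0 : R)^'+, 0 < h by exact: nbhs_right_gt.
have [a0|a0|a0] := ltgtP a 0.
- left; apply: filterS3 kab hpos (hb (negbT (lt_eqF a0))) => h -> h0.
  rewrite (ltr0_norm a0) => hba; have := ler_norm b.
  rewrite -(ler_pM2l h0) => hb'; rewrite /GRing.scale/=; lra.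
- right; apply: filterS3 kab hpos (hb (negbT (gt_eqF a0))) => h -> h0.
  rewrite (gtr0_norm a0) => hba; have := ler_norm (- b).
  rewrite normrN -(ler_pM2l h0) => hb'; rewrite /GRing.scale/=; lra.
- have [b0|b0] := ltP b 0; [left|right]; apply: filterS2 kab hpos => h -> h0;
    rewrite a0 add0r /GRing.scale/=; nra.
Qed.

Lemma affine_germ_abs (k : R -> R^o) :
  affine_germ k -> affine_germ (fun h => `|k h| : R^o).
Proof.
move=> /[dup] kaff /affine_germ_sign[k0|k0].
  apply: (@affine_germ_ext _ (fun h => (-1 : R) *: k h)).
    by apply: filterS k0 => h h0; rewrite ltr0_norm// scaleN1r.
  exact: affine_germ_linear.
by apply: affine_germ_ext kaff; apply: filterS k0 => h h0; rewrite ger0_norm.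
Qed.

Lemma affine_germ_if (W : lmodType R) (c : R -> R^o) (k k' : R -> W) :
  affine_germ c -> affine_germ k -> affine_germ k' ->
  affine_germ (fun h => if c h < 0 then k h else k' h).
Proof.
move=> /affine_germ_sign[c0|c0] kaff k'aff.
  by apply: affine_germ_ext kaff; apply: filterS c0 => h ->.
apply: affine_germ_ext k'aff; apply: filterS c0 => h.
by rewrite leNgt => /negbTE ->.
Qed.

(* [d] is [1] or [- 1], for the right or the left germ at [s]. *)
Definition germ (g : R -> V) (s d : R) : Prop :=
  exists b, \forall h \near 0^'+, g (s + d * h) = g s + h *: b.

(** One-sided germs can be followed through a map without choosing subdivisions; compactness gives a
    partition back in [locally_linear_affine_pieces]. *)
Definition locally_linear (l m : R) (g : R -> V) : Prop :=
  forall s, (l <= s < m -> germ g s 1) /\ (l < s <= m -> germ g s (- 1)).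

Definition pl_arc (l m : R) (g : R -> V) : Prop :=
  {within `[l, m], continuous g} /\ locally_linear l m g.

Lemma within_continuous_near (W : normedModType R) (A : set R) (g : R -> W) (s e : R) :
  {within A, continuous g} -> A s -> 0 < e ->
  \forall s' \near s, A s' -> `|g s' - g s| < e.
Proof.
move=> /subspace_continuousP cg As e0.
have := cg s As _ (nbhsx_ballx (g s) e e0).
move=> cgs; near=> s' => As'.
have /(_ As') /= : A s' -> ball (g s) e (g s') by near: s'; exact: cgs.
by rewrite -ball_normE/= distrC.
Unshelve. all: by end_near.
Qed.

Lemma germ_near (l m : R) (s d : R) : (d = 1 /\ l <= s < m) \/ (d = -1 /\ l < s <= m) ->
  \forall h \near 0^'+, s + d * h \in `[l, m].
Proof.
case=> [] [-> /andP[ls sm]].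
  have sm0 : 0 < m - s by rewrite subr_gt0.
  apply: filterS2 (nbhs_right_gt 0) (nbhs_right_lt sm0) => h h0 hm.
  by rewrite in_itv/=; apply/andP; split; lra.
have sm0 : 0 < s - l by rewrite subr_gt0.
apply: filterS2 (nbhs_right_gt 0) (nbhs_right_lt sm0) => h h0 hm.
by rewrite in_itv/=; apply/andP; split; lra.
Qed.

(** Continuity at [s] forces the constant term of the germ to be [g s]. *)
Lemma germ_of_affine_germ (l m : R) (g : R -> V) (s d : R) :
  {within `[l, m], continuous g} ->
  (d = 1 /\ l <= s < m) \/ (d = -1 /\ l < s <= m) ->
  affine_germ (fun h => g (s + d * h)) -> germ g s d.
Proof.
move=> cg sd [a [b gab]].
suff ag : a = g s by exists b; rewrite -ag.
have slm : `[l, m]%classic s.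
  by case: sd => [] [_ /andP[? ?]]; rewrite /= in_itv/=; apply/andP; split; lra.
apply/eqP; rewrite -subr_eq0 -normr_le0 leNgt; apply/negP => ags0.
have [e e0 ee] : exists2 e, 0 < e & `|a - g s| = e + e.
  by exists (`|a - g s| / 2); lra.
have sdh : s + d * h @[h --> 0^'+] --> s.
  rewrite -[X in _ --> X]addr0 -[in X in _ --> X](mulr0 d).
  apply: cvgD; first exact: cvg_cst.
  apply: cvgM; first exact: cvg_cst.
  by apply: cvg_at_right_filter; exact: cvg_id.
have /sdh near1 := within_continuous_near cg slm e0.
have near2 := germ_near sd.
have b0 : 0 < e / (`|b| + 1) by rewrite divr_gt0// ltr_wpDl.
near (0 : R)^'+ => h.
have h0 : 0 < h by near: h; exact: nbhs_right_gt.
suff : `|a - g s| < e + e by rewrite ee ltxx.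
have -> : a - g s = (g (s + d * h) - g s) - h *: b.
  by rewrite (near gab h)// addrAC addrK.
apply: le_lt_trans (ler_normB _ _) _; apply: ltrD.
  have slmh : `[l, m]%classic (s + d * h) by near: h; exact: near2.
  by move: slmh; near: h; exact: near1.
rewrite normrZ gtr0_norm//.
have : h < e / (`|b| + 1) by near: h; exact: nbhs_right_lt.
rewrite ltr_pdivlMr ?ltr_wpDl// mulrDr mulr1; apply: le_lt_trans.
by rewrite lerDl ltW.
Unshelve. all: by end_near. Qed.

Lemma at_right_exists (P : R -> Prop) : (\forall h \near 0^'+, P h) ->
  exists2 e, 0 < e & forall h, 0 < h <= e -> P h.
Proof.
rewrite near_withinE => /nbhs_ballP[e /= e0 Pe]; exists (e / 2); first lra.
move=> h /andP[h0 he]; apply: Pe => //.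
by rewrite -ball_normE/= sub0r normrN gtr0_norm//; lra.
Qed.

Lemma near_at_right (P : R -> Prop) (e : R) : 0 < e ->
  (forall h, 0 < h < e -> P h) -> \forall h \near 0^'+, P h.
Proof.
move=> e0 Pe; apply: filterS2 (nbhs_right_gt 0) (nbhs_right_lt e0) => h h0 he.
by apply: Pe; rewrite h0.
Qed.

(** Each piece is anchored at its left node, which suits induction on the partition. *)
Fixpoint affine_pieces (g : R -> V) (a : R) (s : seq R) : Prop :=
  match s with
  | [::] => True
  | c :: s' => (exists b, forall t, t \in `[a, c] -> g t = g a + (t - a) *: b) /\
               affine_pieces g c s'
  end.

Lemma affine_piecesP (g : R -> V) (a m : R) (s : seq R) : itv_partition a m s ->
  affine_pieces g a s <-> forall i, (i < size s)%N -> exists u v : V,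
    forall t, t \in `[nth 0 (a :: s) i, nth 0 s i] -> g t = u + t *: v.
Proof.
elim: s a => [//|c s IH] a /[dup] /itv_partition_cons/IH{}IH [/= /andP[ac _] _].
split=> [[[b gb] /IH pcs] [_|i /pcs //]|pcs].
  exists (g a - a *: b), b => t /gb ->.
  by rewrite scalerBl addrA addrAC.
split; last by apply/IH => i; exact: (pcs i.+1).
have [u [v guv]] := pcs 0%N isT; exists v => t tac; rewrite !guv//=.
  by rewrite scalerBl -addrA subrKC.
by rewrite in_itv/= lexx ltW.
Qed.

Lemma affine_pieces_locally_linear (g : R -> V) (a m : R) (s : seq R) :
  itv_partition a m s -> affine_pieces g a s -> locally_linear a m g.
Proof.
elim: s a => [|c s IH] a.
  move=> /itv_partition_nil -> _ s; split=> /andP[? ?]; exfalso; lra.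
move=> /[dup] /itv_partition_cons/IH{}IH [/= /andP[ac _] _] [[b gb] /IH{}IH] x.
have gerr d h : a <= x <= c -> a <= x + d * h <= c ->
    g (x + d * h) = g x + h *: (d *: b).
  move=> sac shac; rewrite (gb (x + d * h)) ?in_itv// (gb x) ?in_itv//.
  rewrite -[RHS]addrA scalerA -scalerDl.
  by congr (_ + _ *: _); ring.
split=> /andP[ax xm].
- have [xc|cx] := ltP x c; last by apply: (IH x).1; rewrite cx.
  exists (1 *: b); apply: (@near_at_right _ (c - x)) => [|h /andP[h0 hc]]; first lra.
  by apply: gerr; apply/andP; split; lra.
- have [xc|cx] := leP x c; last by apply: (IH x).2; rewrite cx.
  exists (- 1 *: b); apply: (@near_at_right _ (x - a)) => [|h /andP[h0 hc]]; first lra.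
  by apply: gerr; apply/andP; split; lra.
Qed.

(** This is induction along the interval, from [m] downwards: [A] is the set of points from which a
    partition reaches [m]. Right germs show that its infimum belongs to it, left germs that the
    infimum is [l]. *)
Lemma locally_linear_affine_pieces (g : R -> V) (l m : R) : l <= m ->
  locally_linear l m g ->
  exists2 s, itv_partition l m s & affine_pieces g l s.
Proof.
move=> lm gl.
pose A := [set c | l <= c <= m /\ exists2 s, itv_partition c m s & affine_pieces g c s].
have Acons a c b : l <= a -> a < c -> A c ->
    (forall t, t \in `[a, c] -> g t = g a + (t - a) *: b) -> A a.
  move=> la ac [/andP[lc cm] [s [ps es] pcs]] gb; split; first by apply/andP; split; lra.
  exists (c :: s); last by split=> //; exists b.
  by split=> //=; rewrite ac.
have Am : A m.
  by split; [rewrite lm lexx|exists [::]].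
have infA : has_inf A.
  by split; [exists m|exists l => c [/andP[]]].
have lA : lbound A `<=` [set x | x <= inf A] by move=> x; apply: lb_le_inf; exists m.
pose c0 := inf A.
have lc0 : l <= c0 by apply: lA => c [/andP[]].
have c0m : c0 <= m by apply: ge_inf => //; exact: infA.2.
have Ac0 : A c0.
  (* Some point of [A] lies so close above [c0] that the right germ at [c0] supplies the piece
     between them. *)
  have [c0m'|mc0] := ltP c0 m; last by rewrite (_ : c0 = m)//; apply/le_anti; rewrite c0m.
  have [b /at_right_exists[e e0 gb]] : germ g c0 1 by apply: (gl c0).1; rewrite lc0.
  have [c Ac cc0] := inf_adherent e0 infA.
  have : c0 <= c by apply: ge_inf => //; exact: infA.2.
  rewrite le_eqVlt => /predU1P[->//|c0c].
  apply: (Acons c0 c b) => // t; rewrite in_itv/= => /andP[].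
  rewrite le_eqVlt => /predU1P[<- _|c0t tc]; first by rewrite subrr scale0r addr0.
  rewrite -gb; first by congr (g _); ring.
  by apply/andP; split; [lra|rewrite -/c0 in cc0; lra].
have [lc0'|c0l] := ltP l c0; last first.
  by have -> : l = c0; [apply/le_anti; rewrite lc0|exact: Ac0.2].
have [b /at_right_exists[e e0 gb]] : germ g c0 (- 1) by apply: (gl c0).2; rewrite lc0'.
pose d := Num.min e (c0 - l).
have d0 : 0 < d by rewrite lt_min e0 subr_gt0.
have de : d <= e by rewrite ge_min lexx.
have dl : d <= c0 - l by rewrite ge_min lexx orbT.
(* The left germ puts a point below [c0] into [A], against the choice of [c0] as infimum. *)
suff /(ge_inf infA.2) : A (c0 - d) by rewrite -/c0; lra.
apply: (Acons _ c0 (- b)) => //; [lra|lra|].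
have gt : forall t, t \in `[c0 - d, c0] -> g t = g c0 + (c0 - t) *: b.
  move=> t; rewrite in_itv/= => /andP[dt].
  rewrite le_eqVlt => /predU1P[->|tc0]; first by rewrite subrr scale0r addr0.
  rewrite -gb; first by congr (g _); ring.
  by apply/andP; split; lra.
move=> t tc; rewrite (gt t)// (gt (c0 - d)); last by rewrite in_itv/= lexx/=; lra.
rewrite -[RHS]addrA scalerN -scalerBl; congr (_ + _ *: _); ring.
Qed.

End Germs.

(** * Collapsing a segment *)

Section Slide.
Variable R : realType.
Implicit Types M t r : R.

(* A point at height [t] above [b] along the segment from [b] ([t = 0]) to
   [b + u] ([t = 1]), and at distance [r] from its axis, will be moved by
   [- slide M t r *: u].  On the segment [slide M t 0 = t], so the segment goes
   to [b].  No piecewise linear map that collapses exactly a segment exists;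
   here the nonlinear part is confined to [M r < t < 1 - M r], a spindle around
   the segment that the other arcs avoid when [M] is large: [slide] is [0]
   below it and [cap] above it. *)
Definition clamp (x : R) : R := Num.max 0 (Num.min 1 x).

(** This taper is 1 on the segment and vanishes once r + max 0 (t - 1) reaches 1 / M^2. The square
    matters in [slide_mono], where M^2 r has to exceed 2 M r. *)
Definition cap M t r : R := Num.max 0 (1 - M ^+ 2 * (r + Num.max 0 (t - 1))).

Definition slide M t r : R :=
  clamp ((t - M * r) / Num.max (1 - 2 * M * r) (1 / 3)) * cap M t r.

Lemma clampP (x : R) : [\/ x <= 0 /\ clamp x = 0, 1 <= x /\ clamp x = 1 |
  [/\ 0 <= x, x <= 1 & clamp x = x]].
Proof.
rewrite /clamp; have [x1|x1] := lerP 1 x.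
  by constructor 2; rewrite max_r.
by have [x0|x0] := lerP x 0; [constructor 1|constructor 3; rewrite !ltW].
Qed.

Lemma capP M t r : [\/ 1 <= M ^+ 2 * (r + Num.max 0 (t - 1)) /\ cap M t r = 0 |
  M ^+ 2 * (r + Num.max 0 (t - 1)) < 1 /\
  cap M t r = 1 - M ^+ 2 * (r + Num.max 0 (t - 1))].
Proof.
rewrite /cap; set x := M ^+ 2 * _; have [x1|x1] := lerP 1 x.
  by left; split=> //; rewrite max_l//; lra.
by right; split=> //; rewrite max_r//; lra.
Qed.

(** Where [cap] is positive this gives M r < 1 / M <= 1 / 3, so the denominator in [slide] is 1 - 2
    M r there; the floor 1 / 3 keeps it positive elsewhere. *)
Lemma cap_small M t r : 3 <= M -> 0 <= r -> M ^+ 2 * (r + Num.max 0 (t - 1)) < 1 ->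
  M * (M * r) < 1.
Proof.
move=> M3 r0; have m0 : 0 <= Num.max 0 (t - 1) by rewrite le_max lexx.
move=> lt1; apply: le_lt_trans lt1.
rewrite mulrDr mulrA -expr2 lerDl mulr_ge0// exprn_ge0//; lra.
Qed.

Lemma slide_bound M t r : 3 <= M -> 0 <= r -> 0 <= slide M t r <= 1.
Proof.
move=> M3 r0; rewrite /slide.
have m0 : 0 <= Num.max 0 (t - 1) by rewrite le_max lexx.
have : 0 <= M ^+ 2 * (r + Num.max 0 (t - 1)).
  by rewrite mulr_ge0 ?addr_ge0// exprn_ge0//; lra.
have [[_ ->]|[? ->]] := capP M t r; first by rewrite mulr0 lexx ler01.
by case: (clampP ((t - M * r) / Num.max (1 - 2 * M * r) (1 / 3)))
    => [[_ ->]|[_ ->]|[? ? ->]] ?; apply/andP; split; nra.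
Qed.

Lemma slide0 M t r : t <= M * r -> slide M t r = 0.
Proof.
move=> tM; rewrite /slide.
have D0 : 0 < Num.max (1 - 2 * M * r) (1 / 3) by rewrite lt_max; apply/orP; right; lra.
set X := (t - M * r) / _; have X0 : X <= 0 by rewrite pmulr_lle0 ?invr_gt0// subr_le0.
by rewrite /clamp min_r ?max_l ?mul0r// (le_trans X0).
Qed.

Lemma slide_cap M t r : 3 <= M -> 0 <= r -> 1 - M * r <= t ->
  slide M t r = cap M t r.
Proof.
move=> M3 r0 tM; rewrite /slide.
have [[_ ->]|[/cap_small small _]] := capP M t r; first by rewrite mulr0.
have Mr : M * r < 1 / 3 by have := small M3 r0; nra.
rewrite max_l; last by nra.
(* The numerator is at least 1 - 2 M r, so the clamp saturates. *)
set X := (t - M * r) / _; have X1 : 1 <= X by rewrite ler_pdivlMr; nra.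
by rewrite /clamp min_l// max_r// mul1r.
Qed.

Lemma slide_axis M t : 3 <= M -> 0 <= t <= 1 -> slide M t 0 = t.
Proof.
move=> M3 /andP[t0 t1]; rewrite /slide /cap /clamp !mulr0 !subr0 add0r.
rewrite (@max_l _ _ 0 (t - 1)) ?subr_le0// mulr0 subr0 (@max_l _ _ 1); last lra.
by rewrite divr1 min_r// !max_r// mulr1.
Qed.

Lemma clamp_lip (x y : R) : x <= y -> 0 <= clamp y - clamp x <= y - x.
Proof.
move=> xy; case: (clampP x) => [[? ->]|[? ->]|[? ? ->]];
  by case: (clampP y) => [[? ->]|[? ->]|[? ? ->]]; apply/andP; split; lra.
Qed.

Lemma cap_noninc M t t' r : t <= t' -> cap M t' r <= cap M t r.
Proof.
move=> tt'; rewrite /cap; have M0 : 0 <= M ^+ 2 by exact: sqr_ge0.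
have mm' : Num.max 0 (t - 1) <= Num.max 0 (t' - 1).
  by rewrite ge_max !le_max lexx/=; apply/orP; right; lra.
by rewrite ge_max !le_max lexx/=; apply/orP; right; nra.
Qed.

Lemma cap_ge0 M t r : 0 <= cap M t r.
Proof. by rewrite le_max lexx. Qed.

(* Off the axis [t - slide M t r] has slope at least
   [1 - (1 - M^2 r) / (1 - 2 M r) > 0]. *)
Lemma slide_mono M t t' r : 3 <= M -> 0 <= r -> t < t' ->
  t' - slide M t' r <= t - slide M t r -> [/\ r = 0, 0 <= t & t' <= 1].
Proof.
move=> M3 r0 tt'; rewrite /slide.
set D := Num.max _ _; set k := cap M t r; set k' := cap M t' r.
have D0 : 0 < D by rewrite lt_max; apply/orP; right; lra.
have tD : (t - M * r) / D <= (t' - M * r) / D.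
  by rewrite ler_pM2r ?invr_gt0//; lra.
have /andP[] := clamp_lip tD.
rewrite (_ : _ / D - _ / D = (t' - t) / D); last by rewrite -mulrBl; congr (_ / _); ring.
set c := clamp ((t - _) / _); set c' := clamp ((t' - _) / _) => cc' lip.
have lipD : (c' - c) * D <= t' - t by rewrite -ler_pdivlMr//; lra.
have k'0 : 0 <= k' by exact: cap_ge0.
have kk' : k' <= k by exact/cap_noninc/ltW.
have c'0 : 0 <= c'.
  by rewrite /c' /clamp le_max lexx.
move=> le.
(* The assumption bounds [t' - t] by c' k' - c k, and [k'] may be raised to [k] because [c'] is
   nonnegative. *)
have ckc : t' - t <= (c' - c) * k.
  have : 0 <= c' * (k - k') by rewrite mulr_ge0// subr_ge0.
  by rewrite mulrBr mulrBl; lra.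
have [[_ k0]|[Mr1 kE]] := capP M t r; first by move: ckc; rewrite /k k0; lra.
have Mr := cap_small M3 r0 Mr1.
have DE : D = 1 - 2 * M * r by rewrite /D max_l//; nra.
have m0 : 0 <= Num.max 0 (t - 1) by rewrite le_max lexx.
have kr : k <= 1 - M ^+ 2 * (r + Num.max 0 (t - 1)) by rewrite /k kE.
have cc : 0 < c' - c by nra.
(* The Lipschitz bound on the clamp meets [ckc] here. For r > 0 the result contradicts k <= 1 - M^2
   r < 1 - 2 M r = D. *)
have kD : D <= k by rewrite -(ler_pM2l cc); lra.
have r0' : r = 0.
  apply/le_anti; rewrite r0 andbT leNgt; apply/negP => r1.
  have : 2 * M * r < M ^+ 2 * r by rewrite ltr_pM2r// expr2; nra.
  have : 0 <= M ^+ 2 * Num.max 0 (t - 1) by rewrite mulr_ge0// sqr_ge0.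
  by move: kD; rewrite DE; nra.
have D1 : D = 1 by rewrite DE r0' mulr0 subr0.
have k1 : k = 1.
  apply/le_anti; rewrite -{2}D1 kD andbT.
  apply: le_trans kr _; have : 0 <= M ^+ 2 * (r + Num.max 0 (t - 1)).
    by rewrite mulr_ge0 ?addr_ge0// sqr_ge0.
  by lra.
(* On the axis the clamp must now grow at full rate from [t] to [t'], which happens only inside
   [0, 1]. *)
have cE : t' - t <= c' - c by move: ckc; rewrite k1 mulr1.
move: cE; rewrite /c /c' D1 r0' mulr0 !subr0 !divr1.
by case: (clampP t) => [[? ->]|[? ->]|[? ? ->]];
  case: (clampP t') => [[? ->]|[? ->]|[? ? ->]] ?; split=> //; lra.
Qed.

End Slide.

Lemma continuous_slide (R : realType) (T : topologicalType) (M : R) (f g : T -> R) :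
  continuous f -> continuous g -> continuous (fun x => slide M (f x) (g x)).
Proof.
move=> cf cg x; move: x (cf x) (cg x) => x {}cf {}cg.
have cst (c : R) : {for x, continuous (fun=> c : R)} by exact: cst_continuous.
have cmax (f1 f2 : T -> R) : {for x, continuous f1} -> {for x, continuous f2} ->
    {for x, continuous (fun y => Num.max (f1 y) (f2 y))}.
  exact: continuous_max.
have cmin (f1 f2 : T -> R) : {for x, continuous f1} -> {for x, continuous f2} ->
    {for x, continuous (fun y => Num.min (f1 y) (f2 y))}.
  exact: continuous_min.
have cM (f1 f2 : T -> R) : {for x, continuous f1} -> {for x, continuous f2} ->
    {for x, continuous (fun y => f1 y * f2 y)}.
  exact: continuousM.
have cB (f1 f2 : T -> R) : {for x, continuous f1} -> {for x, continuous f2} ->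
    {for x, continuous (fun y => f1 y - f2 y)}.
  exact: continuousB.
have cD (f1 f2 : T -> R) : {for x, continuous f1} -> {for x, continuous f2} ->
    {for x, continuous (fun y => f1 y + f2 y)}.
  exact: continuousD.
rewrite /slide /clamp /cap.
apply: (cM); last by apply: (cmax) => //; apply: (cB) => //; apply: (cM) => //;
  apply: (cD) => //; apply: (cmax) => //; apply: (cB).
apply: (cmax) => //; apply: (cmin) => //; apply: (cM); first by apply: (cB) => //; exact: (cM).
apply: continuousV; first by rewrite gt_eqF// lt_max; apply/orP; right; lra.
by apply: (cmax) => //; apply: (cB) => //; exact: (cM).
Qed.

(** * The squeeze of space along a segment *)

Section Squeeze.
Variables (R : realType) (b u : 'rV[R]_3) (i0 : 'I_3).
Hypothesis u0 : u 0 i0 != 0.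
Notation V := 'rV[R]_3.

(** The height comes from an oblique projection that reads one coordinate in which [u] does not
    vanish. *)
Definition axial (z : V) : R := (z - b) 0 i0 / u 0 i0.

(** The l1 norm is piecewise linear in [z], which later keeps squeezed arcs piecewise linear. *)
Definition radial (z : V) : R := \sum_j `|(z - b - axial z *: u) 0 j|.

Definition squeeze (M : R) (z : V) : V := z - slide M (axial z) (radial z) *: u.

Definition axis : set V := [set b + t *: u | t in `[0, 1]].

Lemma axialD z t : axial (z + t *: u) = axial z + t.
Proof. by rewrite /axial !mxE; field. Qed.

Lemma radialD z t : radial (z + t *: u) = radial z.
Proof.
apply: eq_bigr => j _; rewrite axialD; congr (`| (_ : V) 0 j|).
by rewrite scalerDl; apply/rowP => k; rewrite !mxE; ring.
Qed.

Lemma axial_line t : axial (b + t *: u) = t.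
Proof. by rewrite axialD /axial subrr mxE mul0r add0r. Qed.

Lemma radial_line t : radial (b + t *: u) = 0.
Proof.
rewrite radialD; apply: big1 => j _.
have ab : axial b = 0 by rewrite /axial subrr mxE mul0r.
by rewrite ab scale0r subr0 subrr mxE normr0.
Qed.

Lemma radial_ge0 z : 0 <= radial z.
Proof. exact: sumr_ge0. Qed.

Lemma radial_eq0 z : radial z = 0 -> z = b + axial z *: u.
Proof.
move/eqP; rewrite psumr_eq0// => /allP z0; apply/eqP.
rewrite -subr_eq0 opprD addrA; apply/eqP/rowP => j.
by have /eqP := z0 j (mem_index_enum _) => /normr0P/eqP ->; rewrite mxE.
Qed.

Lemma axial_continuous : continuous axial.
Proof.
move=> z; apply: (@continuousM _ _ (fun z : V => (z - b) 0 i0)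
                                   (fun=> (u 0 i0)^-1)); last exact: cst_continuous.
apply: (@continuous_comp _ _ _ (fun z : V => z - b) (fun z : V => z 0 i0)).
  by apply: continuousB; [exact: cvg_id|exact: cst_continuous].
exact: coord_continuous.
Qed.

Lemma radial_continuous : continuous radial.
Proof.
apply: continuous_big => [|j _ z]; first exact: add_continuous.
apply: (@continuous_comp _ _ _ (fun z : V => (z - b - axial z *: u) 0 j) Num.norm).
  apply: (@continuous_comp _ _ _ (fun z : V => z - b - axial z *: u)
                                 (fun z : V => z 0 j)).
    apply: continuousB; first by apply: continuousB; [exact: cvg_id|exact: cst_continuous].
    by apply: continuousZr_tmp; exact: axial_continuous.
  exact: coord_continuous.
exact: norm_continuous.
Qed.

Lemma squeeze_continuous M : continuous (squeeze M).
Proof.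
move=> z.
apply: (@continuousB _ _ _ id (fun z => slide M (axial z) (radial z) *: u)).
  exact: cvg_id.
apply: continuousZr_tmp; exact: (continuous_slide axial_continuous radial_continuous).
Qed.

Lemma axial_squeeze M z :
  axial (squeeze M z) = axial z - slide M (axial z) (radial z).
Proof. by rewrite /squeeze -scaleNr axialD. Qed.

Lemma radial_squeeze M z : radial (squeeze M z) = radial z.
Proof. by rewrite /squeeze -scaleNr radialD. Qed.

Lemma squeeze_axis M z : 3 <= M -> axis z -> squeeze M z = b.
Proof.
move=> M3 [t]; rewrite /= in_itv/= => t01 <-.
by rewrite /squeeze axial_line radial_line slide_axis// addrK.
Qed.

(** The squeeze moves points parallel to [u] and preserves [radial], so everything happens on one
    line, where [slide_mono] makes the new height strictly increasing off the axis. *)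
Lemma squeeze_inj M x y : 3 <= M -> axial x <= axial y ->
  squeeze M x = squeeze M y -> x = y \/ axis x /\ axis y.
Proof.
move=> M3 xy qxy.
have rxy : radial x = radial y.
  by rewrite -(radial_squeeze M x) qxy radial_squeeze.
have := congr1 axial qxy; rewrite !axial_squeeze -rxy => axy.
move: xy; rewrite le_eqVlt => /predU1P[axyE|xy].
  left; move: qxy; rewrite /squeeze rxy axyE; exact: addIr.
have [|rx0 x0 y1] := slide_mono M3 (radial_ge0 x) xy.
  by rewrite axy.
right; split; last rewrite rx0 in rxy.
  exists (axial x); last by rewrite -radial_eq0.
  by rewrite /= in_itv/= x0/=; lra.
exists (axial y); last by rewrite -radial_eq0.
by rewrite /= in_itv/= y1; apply/andP; split=> //; lra.
Qed.

Lemma collapse_squeeze M : 3 <= M -> collapse (squeeze M) axis.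
Proof.
move=> M3; split.
- exact: squeeze_continuous.
- apply: (@closed_image_bounded_displacement _ _ `|u|).
    exact: squeeze_continuous.
  move=> z; rewrite /squeeze addrAC subrr add0r normrN normrZ.
  have /andP[s0 s1] := slide_bound (axial z) M3 (radial_ge0 z).
  by rewrite ger0_norm// ler_piMl.
- move=> y.
  (* On the line through [y], a preimage is [y + a *: u] with [f a = 0]. Since [slide] takes values
     in [0, 1], f 0 <= 0 <= f 1. *)
  pose f (a : R) := a - slide M (axial y + a) (radial y).
  have cf : continuous f.
    move=> a.
    apply: (@continuousB _ _ _ id (fun a => slide M (axial y + a) (radial y))).
      exact: cvg_id.
    have := @continuous_slide R R M (fun a => axial y + a) (fun=> radial y).
    apply => x; last exact: cst_continuous.
    by apply: (@continuousD _ _ _ (fun=> axial y) id); [exact: cst_continuous|exact: cvg_id].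
  have [||a _ fa0] := @IVT R f 0 1 0 ler01.
  + exact: continuous_subspaceT.
  + rewrite /f ge_min le_max.
    have /andP[s0 _] := slide_bound (axial y + 0) M3 (radial_ge0 y).
    have /andP[_ s1] := slide_bound (axial y + 1) M3 (radial_ge0 y).
    by apply/andP; split; apply/orP; [left|right]; lra.
  exists (y + a *: u); rewrite /squeeze axialD radialD.
  move/eqP: fa0; rewrite subr_eq0 => /eqP <-.
  by rewrite addrK.
- apply: connected_continuous_connected.
    by apply/connected_intervalP; exact: interval_is_interval.
  apply: continuous_subspaceT => t.
  apply: (@continuousD R V _ (fun=> b) (fun t : R => t *: u)).
    exact: cst_continuous.
  by apply: continuousZr_tmp; exact: cvg_id.
- move=> x y; split=> [qxy|[->//|[x01 y01]]]; last by rewrite !squeeze_axis.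
  have [xy|/ltW yx] := leP (axial x) (axial y); first exact: squeeze_inj qxy.
  have [] := squeeze_inj M3 yx (esym qxy); first by left.
  by move=> []; right.
Qed.

End Squeeze.

(** Thresholds for [M] found locally along a compact parameter set combine into one. *)
Lemma compact_near_pinfty (R : realType) (K : set R) (P : R -> R -> Prop) :
  compact K ->
  (forall x, K x -> exists e M0, 0 < e /\
     forall s M, K s -> `|s - x| < e -> M0 <= M -> P M s) ->
  \forall M \near +oo, forall s, K s -> P M s.
Proof.
move=> /compact_near_coveringP/near_covering_withinP cK loc.
apply: (cK R +oo P) => x Kx; have [e [M0 [e0 PM]]] := loc x Kx.
exists ([set s | `|s - x| < e], [set M | M0 <= M]) => [|[s M] /= [se MM] Ks]; last exact: PM.
split=> /=; last by apply: nbhs_pinfty_ge; exact: num_real.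
by apply/nbhs_ballP; exists e => //= s; rewrite -ball_normE /= distrC.
Qed.

(** * How arcs meet the spindle and the cap *)

Section SqueezeArcs.
Variables (R : realType) (b u : 'rV[R]_3) (i0 : 'I_3).
Hypothesis u0 : u 0 i0 != 0.
Notation V := 'rV[R]_3.
Notation axial := (axial b u i0).
Notation radial := (radial b u i0).
Notation axis := (axis b u).

(** Off this closed zone [slide] is either 0 or [cap]. *)
Definition spindle (M : R) (z : V) : Prop :=
  M * radial z <= axial z <= 1 - M * radial z.

(** Here [slide] equals [cap], and [cap] is positive. *)
Definition capped (M : R) (z : V) : Prop :=
  1 - M * radial z <= axial z /\
  M ^+ 2 * (radial z + Num.max 0 (axial z - 1)) < 1.

Lemma axial_base : axial b = 0.
Proof. by have := axial_line b u0 0; rewrite scale0r addr0. Qed.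

Lemma radial_base : radial b = 0.
Proof. by have := radial_line b u0 0; rewrite scale0r addr0. Qed.

Lemma axial_tip : axial (b + u) = 1.
Proof. by have := axial_line b u0 1; rewrite scale1r. Qed.

Lemma radial_tip : radial (b + u) = 0.
Proof. by have := radial_line b u0 1; rewrite scale1r. Qed.

Lemma axisP z : axis z <-> radial z = 0 /\ 0 <= axial z <= 1.
Proof.
split=> [[t t01 <-]|[r0 a01]].
  by rewrite radial_line// axial_line//; move: t01; rewrite /= in_itv.
by exists (axial z); [rewrite /= in_itv|rewrite -(radial_eq0 r0)].
Qed.

Lemma axial_ray z v h : axial (z + h *: v) = axial z + h * (v 0 i0 / u 0 i0).
Proof. by rewrite /axial !mxE; field. Qed.

(** As [radial] measures from [b], [radial (b + v)] is the seminorm of the direction [v]. *)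
Lemma radial_ray z v h : radial z = 0 -> 0 <= h ->
  radial (z + h *: v) = h * radial (b + v).
Proof.
move=> r0 h0; rewrite {1}(radial_eq0 r0) /radial mulr_sumr.
apply: eq_bigr => j _; rewrite -[X in _ = X * _](ger0_norm h0) -normrM.
by congr `| _ |; rewrite axial_ray axial_line// /axial !mxE; field.
Qed.

Lemma slide_capped M z : 3 <= M -> 1 - M * radial z <= axial z -> ~ capped M z ->
  slide M (axial z) (radial z) = 0.
Proof.
move=> M3 Ma nc; rewrite slide_cap ?radial_ge0//.
by have [[_ ->]//|[c1 _]] := capP M (axial z) (radial z); case: nc.
Qed.

Section Arc.
Variables (l m : R) (g : R -> V).
Hypothesis gpl : pl_arc l m g.
Hypothesis axis_ends : forall s, s \in `[l, m] -> axis (g s) -> g s = b \/ g s = b + u.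

Lemma axial_near s e : s \in `[l, m] -> 0 < e -> exists2 d, 0 < d &
  forall s', s' \in `[l, m] -> `|s' - s| < d -> `|axial (g s') - axial (g s)| < e /\
    `|radial (g s') - radial (g s)| < e.
Proof.
move=> slm e0; have [cg _] := gpl.
have ca : {within `[l, m], continuous (axial \o g)}.
  by apply: within_continuous_comp cg => y _; apply: axial_continuous.
have cr : {within `[l, m], continuous (radial \o g)}.
  by apply: within_continuous_comp cg => y _; apply: radial_continuous.
have na := within_continuous_near ca slm e0.
have nr := within_continuous_near cr slm e0.
case/nbhs_ballP: (@filterI _ _ (nbhs_filter s) _ _ na nr) => d /= d0 dP.
exists d => // s' s'lm; rewrite distrC => s'd.
by have [|p q] := dP s'; [rewrite -ball_normE|split; [exact: p|exact: q]].
Qed.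

(** The spindle shrinks to the segment as [M] grows, so only parameters near an end of the segment
    matter. There the arc is a ray on each side: a ray off the axis leaves a thin spindle at once,
    and a ray inside the axis is limited to the two ends by [axis_ends]. *)
Lemma spindle_avoid : \forall M \near +oo, forall s, s \in `[l, m] ->
  spindle M (g s) -> g s = b \/ g s = b + u.
Proof.
apply: (@compact_near_pinfty _ `[l, m] (fun M s => spindle M (g s) -> _)).
  exact: segment_compact.
move=> s slm; have rs0 := radial_ge0 b u i0 (g s).
have [rpos|r0] : 0 < radial (g s) \/ radial (g s) = 0.
  by move: rs0; rewrite le_eqVlt => /predU1P[<-|]; [right|left].
  have [|d d0 dP] := @axial_near s (radial (g s) / 2) slm; first lra.
  (* Nearby radii exceed half of [radial (g s)], so M r > 1, while the spindle has M r <= 1 / 2. *)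
  exists d, (2 / radial (g s)); split=> // s' M s'lm s'd MM /andP[sp1 sp2].
  have [_] := dP s' s'lm s'd; rewrite ltr_norml => /andP[rr _].
  move: MM; rewrite ler_pdivrMr// => MM; exfalso.
  have M0 : 0 < M by nra.
  by nra.
have [a0|a0] := ltP (axial (g s)) 0.
  have [|d d0 dP] := @axial_near s (- axial (g s)) slm; first lra.
  exists d, 0; split=> // s' M s'lm s'd MM /andP[sp1 sp2].
  have [+ _] := dP s' s'lm s'd; rewrite ltr_norml => /andP[_ rr].
  have rs' := radial_ge0 b u i0 (g s'); exfalso; nra.
have [a1|a1] := ltP 1 (axial (g s)).
  have [|d d0 dP] := @axial_near s (axial (g s) - 1) slm; first lra.
  exists d, 0; split=> // s' M s'lm s'd MM /andP[sp1 sp2].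
  have [+ _] := dP s' s'lm s'd; rewrite ltr_norml => /andP[rr _].
  have rs' := radial_ge0 b u i0 (g s'); exfalso; nra.
have ends : g s = b \/ g s = b + u by apply: axis_ends => //; apply/axisP; rewrite a0.
have ray v : exists M0, forall h M, 0 < h -> M0 <= M -> spindle M (g s + h *: v) ->
    axis (g s + h *: v).
  pose al := v 0 i0 / u 0 i0; pose be := radial (b + v).
  have be0 : 0 <= be by exact: radial_ge0.
  have [be1|be1] := eqVneq be 0.
    exists 0 => h M h0 M0 /andP[]; rewrite axial_ray radial_ray ?(ltW h0)//.
    rewrite -/be be1 !mulr0 subr0 => ax0 ax1; apply/axisP.
    by rewrite axial_ray radial_ray ?(ltW h0)// -/be be1 mulr0 ax0 ax1.
  have be2 : 0 < be by rewrite lt_neqAle eq_sym be1.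
  (* Along the ray the height changes at rate [al] and M r at rate [M * be]; beyond this threshold
     the latter wins. *)
  exists ((`|al| + 1) / be) => h M h0; rewrite ler_pdivrMr// => MM.
  move=> /andP[]; rewrite axial_ray radial_ray ?(ltW h0)// -/be -/al => sp1 sp2.
  exfalso; have := ler_norm (- al); have := ler_norm al; rewrite normrN => n1 n2.
  have : 0 < h * (M * be - `|al|) by rewrite mulr_gt0//; lra.
  case: ends => gs; move: sp1 sp2; rewrite gs.
    by rewrite axial_base; nra.
  by rewrite axial_tip; nra.
have side d : (d = 1 /\ l <= s < m) \/ (d = -1 /\ l < s <= m) ->
   exists e M0, 0 < e /\ forall h M, 0 < h <= e -> M0 <= M -> s + d * h \in `[l, m] ->
     spindle M (g (s + d * h)) -> g (s + d * h) = b \/ g (s + d * h) = b + u.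
  move=> sd; have [v /at_right_exists[e e0 ev]] : germ g s d.
    by have [_ /(_ s)[gr gl]] := gpl; case: sd => [] [-> ?]; auto.
  have [M0 M0P] := ray v; exists e, M0; split=> // h M he MM shlm sp.
  apply: axis_ends => //; rewrite ev//; apply: (M0P h M) => //; last by rewrite -ev.
  by case/andP: he.
have [e1 [M1 [e10 P1]]] : exists e M0, 0 < e /\
    forall s' M, s < s' <= s + e -> s' <= m -> M0 <= M ->
     spindle M (g s') -> g s' = b \/ g s' = b + u.
  have [ls sm] := andP (slm : l <= s <= m).
  (* For [s = m] there is nothing to the right, and the values 1 and 0 are arbitrary. *)
  have [sm'|ms] := ltP s m; last by exists 1, 0; split=> // s' M /andP[? ?] ? ?; exfalso; lra.
  have [|e [M0 [e0 eP]]] := side 1; first by left; rewrite ls.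
  exists e, M0; split=> // s' M /andP[ss' se] s'm MM.
  rewrite -[s'](_ : s + 1 * (s' - s) = _); last by ring.
  by apply: eP => //; [apply/andP; split; lra|rewrite in_itv/=; apply/andP; split; lra].
have [e2 [M2 [e20 P2]]] : exists e M0, 0 < e /\
    forall s' M, s - e <= s' < s -> l <= s' -> M0 <= M ->
     spindle M (g s') -> g s' = b \/ g s' = b + u.
  have [ls sm] := andP (slm : l <= s <= m).
  have [sl'|ls'] := ltP l s; last by exists 1, 0; split=> // s' M /andP[? ?] ? ?; exfalso; lra.
  have [|e [M0 [e0 eP]]] := side (- 1); first by right; rewrite sl'.
  exists e, M0; split=> // s' M /andP[ss' se] s'm MM.
  rewrite -[s'](_ : s + - 1 * (s - s') = _); last by ring.
  by apply: eP => //; [apply/andP; split; lra|rewrite in_itv/=; apply/andP; split; lra].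
exists (Num.min e1 e2), (Num.max M1 M2); split; first by rewrite lt_min e10.
move=> s' M; rewrite /= in_itv/= => /andP[ls' s'm].
rewrite lt_min !ltr_norml ge_max => /andP[/andP[s1 s2] /andP[s3 s4]] /andP[MM1 MM2].
have [ss'|ss'|<-//] := ltgtP s s'.
  by apply: P1 => //; apply/andP; split; lra.
by apply: P2 => //; apply/andP; split; lra.
Qed.

(** The capped region shrinks to the tip [b + u]: on it both M r and M |t - 1| are below 1. *)
Lemma cap_avoid : (forall s, s \in `[l, m] -> g s <> b + u) ->
  \forall M \near +oo, forall s, s \in `[l, m] -> ~ capped M (g s).
Proof.
move=> gx; apply: (@compact_near_pinfty _ `[l, m] (fun M s => ~ capped M (g s))).
  exact: segment_compact.
move=> s slm; have rs0 := radial_ge0 b u i0 (g s).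
pose N := radial (g s) + `|axial (g s) - 1|.
have N0 : 0 < N.
  rewrite lt_neqAle addr_ge0// andbT eq_sym paddr_eq0// normr_eq0 subr_eq0.
  apply/negP => /andP[/eqP r0 /eqP a1].
  by apply: (gx s slm); rewrite (radial_eq0 r0) a1 scale1r.
have N4 : 0 < N / 4 by rewrite divr_gt0.
have [d d0 dP] := @axial_near s (N / 4) slm N4.
(* A capped point has r + |t - 1| < 2 / M, while [g s'] keeps this sum at least [N / 2]; hence 4 /
   N. *)
exists d, (Num.max 3 (4 / N)); split=> // s' M s'lm s'd; rewrite ge_max.
rewrite ler_pdivrMr// => /andP[M3 MN] [c1 c2].
have rs'0 := radial_ge0 b u i0 (g s').
have small := cap_small M3 rs'0 c2.
have mx0 : 0 <= Num.max 0 (axial (g s') - 1) by rewrite le_max lexx.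
have mx1 : axial (g s') - 1 <= Num.max 0 (axial (g s') - 1) by rewrite le_max lexx orbT.
have [] := dP s' s'lm s'd; rewrite !ltr_norml => /andP[a1 a2] /andP[r1 r2].
have : N <= radial (g s') + N / 2 + `|axial (g s') - 1|.
  have : `|axial (g s) - 1| <= `|axial (g s') - 1| + N / 4.
    apply: le_trans (_ : `|axial (g s') - 1| + `|axial (g s) - axial (g s')| <= _).
      by rewrite -[axial (g s) - 1](subrKA (axial (g s'))) addrC ler_normD.
    by rewrite lerD2l distrC ltW// ltr_norml a1.
  by move=> tri; rewrite {1}/N; lra.
have M2r : 0 <= M ^+ 2 * radial (g s') by rewrite mulr_ge0// sqr_ge0.
have Mc : M * (axial (g s') - 1) < 1.
  have : M * (axial (g s') - 1) <= M ^+ 2 * Num.max 0 (axial (g s') - 1).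
    apply: (@le_trans _ _ (M * Num.max 0 (axial (g s') - 1))).
      by rewrite ler_wpM2l//; lra.
    by apply: ler_wpM2r => //; rewrite expr2; nra.
  by rewrite mulrDr in c2; lra.
have Mc' : M * (1 - axial (g s')) < 1 by nra.
have Mr : M * radial (g s') < 1 by nra.
have : M * `|axial (g s') - 1| < 1.
  by case: (ger0P (axial (g s') - 1)) => _; lra.
nra.
Qed.

Lemma squeeze_fixed M : 3 <= M ->
  (forall s, s \in `[l, m] -> spindle M (g s) -> g s = b \/ g s = b + u) ->
  (forall s, s \in `[l, m] -> ~ capped M (g s)) ->
  forall s, s \in `[l, m] -> squeeze b u i0 M (g s) = g s.
Proof.
move=> M3 sp cp s slm; rewrite /squeeze.
suff -> : slide M (axial (g s)) (radial (g s)) = 0 by rewrite scale0r subr0.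
have [aM|Ma] := leP (axial (g s)) (M * radial (g s)); first exact: slide0.
have [aM'|Ma'] := leP (1 - M * radial (g s)) (axial (g s)).
  by apply: slide_capped => //; exact: cp.
have [|gb|gx] := sp s slm; first by rewrite /spindle !ltW.
  by move: Ma; rewrite gb axial_base radial_base mulr0 ltxx.
by move: Ma'; rewrite gx axial_tip radial_tip mulr0 subr0 ltxx.
Qed.

End Arc.
End SqueezeArcs.

(** * Piecewise linearity of squeezed arcs *)

Section SqueezePL.
Variables (R : realType) (b u : 'rV[R]_3) (i0 : 'I_3).
Hypothesis u0 : u 0 i0 != 0.
Notation V := 'rV[R]_3.
Notation axial := (axial b u i0).
Notation radial := (radial b u i0).
Notation axis := (axis b u).

Lemma affine_germ_axial (k : R -> V) :
  affine_germ k -> affine_germ (fun h => axial (k h) : R^o).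
Proof.
move=> [a [c kac]]; exists (axial a), (c 0 i0 / u 0 i0).
by apply: filterS kac => h ->; exact: axial_ray.
Qed.

Lemma affine_germ_radial (k : R -> V) :
  affine_germ k -> affine_germ (fun h => radial (k h) : R^o).
Proof.
move=> kaff; apply: (@affine_germ_sum R R^o) => j; apply: affine_germ_abs.
have [a [c kac]] := kaff; have [a' [c' kac']] := affine_germ_axial kaff.
exists (a 0 j - b 0 j - a' * u 0 j), (c 0 j - c' * u 0 j).
apply: filterS2 kac kac' => h; rewrite !mxE => -> ->.
by rewrite !mxE /GRing.scale/=; ring.
Qed.

Lemma affine_germ_max0 (k : R -> R^o) :
  affine_germ k -> affine_germ (fun h => Num.max 0 (k h) : R^o).
Proof.
move=> kaff; apply: (@affine_germ_ext _ _ (fun h => if k h < 0 then 0 else k h)).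
  by apply: nearW => h; rewrite maxC /Order.max.
by apply: affine_germ_if => //; exact: affine_germ_cst.
Qed.

Lemma affine_germZr (k : R -> R^o) (v : V) :
  affine_germ k -> affine_germ (fun h => (k h : R) *: v).
Proof.
move=> [a [c kac]]; exists (a *: v), (c *: v).
by apply: filterS kac => h ->; rewrite scalerDl scalerA.
Qed.

Lemma affine_germB (W : lmodType R) (k k' : R -> W) :
  affine_germ k -> affine_germ k' -> affine_germ (fun h => k h - k' h).
Proof.
move=> kaff [a [c kac]]; apply: affine_germD => //; exists (- a), (- c).
by apply: filterS kac => h ->; rewrite opprD scalerN.
Qed.

Lemma affine_germZl (c : R) (k : R -> R^o) :
  affine_germ k -> affine_germ (fun h => c * k h : R^o).
Proof.
move=> [a [b' kab]]; exists (c * a), (c * b').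
by apply: filterS kab => h ->; rewrite /GRing.scale/=; ring.
Qed.

Lemma affine_germ_of_germ (g : R -> V) (s d : R) :
  germ g s d -> affine_germ (fun h => g (s + d * h)).
Proof. by move=> [c gc]; exists (g s), c. Qed.

(** The arc meets the spindle at most in [b] and [b + u]. So along it the displacement is 0 or [cap]
    according to the sign of an affine germ, also at these two points. *)
Lemma squeeze_pl_arc (M l m : R) (g : R -> V) : 3 <= M -> pl_arc l m g ->
  (forall s, s \in `[l, m] -> spindle b u i0 M (g s) -> g s = b \/ g s = b + u) ->
  pl_arc l m (squeeze b u i0 M \o g).
Proof.
move=> M3 [cg gl] sp.
have csg : {within `[l, m], continuous (squeeze b u i0 M \o g)}.
  by apply: within_continuous_comp cg => y _; exact: squeeze_continuous.
suff side s d : (d = 1 /\ l <= s < m) \/ (d = -1 /\ l < s <= m) ->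
    germ (squeeze b u i0 M \o g) s d.
  by split=> // s; split=> slm; apply: side; [left|right].
move=> sd; apply: (germ_of_affine_germ csg sd).
have /affine_germ_of_germ kaff : germ g s d.
  by have [gr gl'] := gl s; case: sd => [] [-> ?]; auto.
pose k h := g (s + d * h); rewrite -/k in kaff.
pose f h := if axial (k h) - (1 - M * radial (k h)) < 0 then 0
            else cap M (axial (k h)) (radial (k h)).
apply: (@affine_germ_ext _ _ (fun h => k h - f h *: u)).
  apply: filterS (germ_near sd) => h slm.
  rewrite /= /squeeze -/(k h) /f subr_lt0; congr (_ - _ *: _).
  case: ltP => aM; last by rewrite slide_cap ?radial_ge0.
  have [Ma|Ma] := leP (axial (k h)) (M * radial (k h)); first exact: slide0.
  have [|kb|kx] := sp _ slm; first by rewrite /spindle !ltW.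
    by move: Ma; rewrite /k kb axial_base// radial_base// mulr0 ltxx.
  by move: aM; rewrite /k kx axial_tip// radial_tip// mulr0 subr0 ltxx.
have ka := affine_germ_axial kaff; have kr := affine_germ_radial kaff.
have cst (c : R) : affine_germ (fun=> c : R^o) by exact: affine_germ_cst.
apply: affine_germB => //; apply: affine_germZr.
apply: affine_germ_if; [|exact: cst|].
  by apply: affine_germB => //; apply: affine_germB => //; exact: affine_germZl.
apply: affine_germ_max0; apply: affine_germB => //; apply: affine_germZl.
by apply: affine_germD => //; apply: affine_germ_max0; apply: affine_germB.
Qed.

End SqueezePL.

Section CollapseArc.
Variable R : realType.
Notation V := 'rV[R]_3.

(** There are finitely many arcs, so one [M] serves them all. The end [b + u] is pulled to [b], and
    only arcs through [b + u] may move. *)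
Lemma collapse_segment (I : finType) (b u : V) (l m : I -> R) (g : I -> R -> V) :
  u != 0 -> (forall i, pl_arc (l i) (m i) (g i)) ->
  (forall i s, s \in `[l i, m i] -> axis b u (g i s) -> g i s = b \/ g i s = b + u) ->
  exists q, [/\ collapse q (axis b u), q b = b,
    forall i, pl_arc (l i) (m i) (q \o g i) &
    forall i, (forall s, s \in `[l i, m i] -> g i s <> b + u) ->
      forall s, s \in `[l i, m i] -> q (g i s) = g i s].
Proof.
move=> /rV0Pn[i0 u0] gpl gax.
have spn : \forall M \near +oo, forall i s, s \in `[l i, m i] ->
    spindle b u i0 M (g i s) -> g i s = b \/ g i s = b + u.
  by apply: filter_forall => i; apply: spindle_avoid => //; exact: gax.
have cpn : \forall M \near +oo, forall i, (forall s, s \in `[l i, m i] -> g i s <> b + u) ->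
    forall s, s \in `[l i, m i] -> ~ capped b u i0 M (g i s).
  apply: filter_forall => i.
  have [gi|gi] := pselect (forall s, s \in `[l i, m i] -> g i s <> b + u); last first.
    by apply: nearW => M /gi.
  by near=> M => _; near: M; exact: (cap_avoid i0 (gpl i) gi).
have M3n : \forall M \near +oo, (3 : R) <= M by apply: nbhs_pinfty_ge; exact: num_real.
have [M [[M3 sp] cp]] : exists M, (3 <= M /\ forall i s, s \in `[l i, m i] ->
    spindle b u i0 M (g i s) -> g i s = b \/ g i s = b + u) /\
   forall i, (forall s, s \in `[l i, m i] -> g i s <> b + u) ->
    forall s, s \in `[l i, m i] -> ~ capped b u i0 M (g i s).
  exact: (@filter_ex _ _ _ _ (filterI (filterI M3n spn) cpn)).
exists (squeeze b u i0 M); split.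
- exact: collapse_squeeze.
- by apply: squeeze_axis => //; exists 0; rewrite /= ?in_itv/= ?lexx ?ler01// scale0r addr0.
- by move=> i; apply: squeeze_pl_arc => //; exact: sp.
- move=> i gi; apply: squeeze_fixed => //; [exact: sp|exact: cp].
Unshelve. all: by end_near. Qed.

End CollapseArc.

(** * Collapsing a piecewise linear arc *)

Section CollapseArc.
Variable R : realType.
Notation V := 'rV[R]_3.

(** The base of the segment is its later node [alpha c], because the arc will be collapsed starting
    from [alpha a]. *)
Lemma affine_image_axis (alpha : R -> V) (a c : R) (v : V) : a < c ->
  (forall t, t \in `[a, c] -> alpha t = alpha a + (t - a) *: v) ->
  axis (alpha c) (alpha a - alpha c) = alpha @` `[a, c].
Proof.
move=> ac alv.
have aE t : t \in `[a, c] ->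
    alpha t = alpha c + ((c - t) / (c - a)) *: (alpha a - alpha c).
  move=> tac; rewrite (alv t)// (alv c) ?in_itv/= ?lexx ?ltW//.
  by apply/rowP => j; rewrite !mxE; field; rewrite subr_eq0 gt_eqF.
apply/seteqP; split=> [_ [t + <-]|_ [t tac <-]].
  rewrite /= in_itv/= => /andP[t0 t1]; exists (c - t * (c - a)).
    by rewrite /= in_itv/=; apply/andP; split; nra.
  rewrite aE; last by rewrite in_itv/=; apply/andP; split; nra.
  by congr (_ + _ *: _); field; rewrite subr_eq0 gt_eqF.
exists ((c - t) / (c - a)); last by rewrite -aE.
move: tac; rewrite /= !in_itv/= => /andP[? ?].
have ca : 0 < c - a by rewrite subr_gt0.
by rewrite ler_pdivrMr// pmulr_lge0 ?invr_gt0//; apply/andP; split; lra.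
Qed.

(** By induction on the partition, the first segment is collapsed to its later node. Arcs ending at
    [alpha a] then end at [alpha c], so the new arcs again meet the rest of [alpha] only at its
    ends. *)
Lemma collapse_arc (s : seq R) (I : finType) (a m : R) (alpha : R -> V)
    (g : I -> R -> V) :
  itv_partition a m s -> affine_pieces alpha a s ->
  {within `[a, m], continuous alpha} -> {in `[a, m] &, injective alpha} ->
  (forall i, pl_arc 0 1 (g i)) ->
  (forall i r t, r \in `[0, 1] -> t \in `[a, m] -> g i r = alpha t ->
     t = a \/ t = m) ->
  exists Q, [/\ collapse Q (alpha @` `[a, m]),
    forall i, pl_arc 0 1 (Q \o g i) &
    forall i, (forall r t, r \in `[0, 1] -> t \in `[a, m] -> g i r = alpha t -> t = m) ->
      forall r, r \in `[0, 1] -> Q (g i r) = g i r].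
Proof.
elim: s a g => [|c s IH] a g.
  move=> /itv_partition_nil am _ _ _ gpl gal; exists id; split=> //.
  rewrite am (_ : alpha @` _ = [set alpha m]); first exact: collapse_id.
  by rewrite set_itv1 image_set1.
move=> pcs [[v alv] pieces] cal ial gpl gal.
have ac : a < c by case: pcs => /= /andP[].
have pc := itv_partition_cons pcs; have cm := itv_partition_le pc.
have inI t : a <= t <= m -> t \in `[a, m] by rewrite in_itv.
pose u := alpha a - alpha c.
have bu : alpha c + u = alpha a by rewrite subrKC.
have u0 : u != 0.
  rewrite subr_eq0; apply/eqP => acE.
  have : a = c by apply: ial acE; apply: inI; apply/andP; split; lra.
  lra.
have axE := affine_image_axis ac alv; rewrite -/u in axE.
have axc t : t \in `[c, m] -> axis (alpha c) u (alpha t) -> t = c.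
  rewrite in_itv/= => /andP[ct tm].
  rewrite axE => -[t' + al]; rewrite /= in_itv/= => /andP[at' t'c].
  have tt' : t' = t by apply: ial => //; apply: inI; apply/andP; split; lra.
  by apply/le_anti; rewrite ct -tt' t'c.
(* The rest of [alpha] joins the family as the arc [None]. It misses [alpha a], so the first
   collapse leaves it in place. *)
pose l (i : option I) : R := if i is Some _ then 0 else c.
pose r (i : option I) : R := if i is Some _ then 1 else m.
pose g' (i : option I) := if i is Some j then g j else alpha.
have g'pl i : pl_arc (l i) (r i) (g' i).
  case: i => [i|]; first exact: gpl.
  split; last exact: affine_pieces_locally_linear pc pieces.
  apply: continuous_subspaceW cal => t; rewrite /= !in_itv/= => /andP[? ?].
  by apply/andP; split; lra.
have [|q [cq qb qpl qfix]] := @collapse_segment R _ (alpha c) u l r g' u0 g'pl.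
  move=> [i|] t /= tI; last by move=> /axc -> //; left.
  rewrite bu axE => -[t' + al]; rewrite /= in_itv/= => /andP[at' t'c].
  have [|tE|tE] := gal i t t' tI _ (esym al); first by apply: inI; rewrite at' (le_trans t'c).
    by right; rewrite -al tE.
  left; rewrite -al; congr alpha; apply/le_anti.
  by rewrite t'c tE.
have qal t : t \in `[c, m] -> q (alpha t) = alpha t.
  apply: (qfix None) => /= {}t; rewrite in_itv/= bu => /andP[ct tm] /ial.
  have at' : a <= t by lra.
  have am : a <= m by lra.
  by rewrite !inI ?at' ?lexx ?am// => /(_ isT isT); lra.
have [_ _ _ _ qE] := cq.
have am : a <= m by lra.
have [||||||Q' [cQ' Q'pl Q'fix]] := IH c (fun i => q \o g i).
- exact: pc.
- exact: pieces.
- exact: (g'pl None).1.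
- move=> x y; rewrite !in_itv/= => /andP[? ?] /andP[? ?]; apply: ial; apply: inI;
    by apply/andP; split; lra.
- by move=> i; exact: (qpl (Some i)).
(* A squeezed arc meets the rest of [alpha] where it did before, or at [alpha c]. *)
- move=> i x t x01 tcm /=; rewrite -{1}(qal t tcm) => /qE[gE|[_ /axc]]; last by left; auto.
  have [|ta|] := gal i x t x01 _ gE; [|move: tcm|by right].
    by move: tcm; rewrite !in_itv/= => /andP[? ?]; apply/andP; split; lra.
  by rewrite ta in_itv/= leNgt ac.
exists (Q' \o q); split.
- apply: (collapse_comp cq cQ').
  + apply: connected_continuous_connected => //.
    by apply/connected_intervalP; exact: interval_is_interval.
  + apply/seteqP; split=> [_ [t tam <-]|x [t tcm]] /=.
      have [tc|ct] := leP t c.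
        exists c; first by rewrite /= in_itv/= lexx.
        rewrite -qb; apply/qE; right; rewrite axE; split.
          by exists c; rewrite //= in_itv/= lexx ltW.
        by exists t => //; move: tam; rewrite /= !in_itv/= tc => /andP[-> _].
      have tcm : t \in `[c, m].
        by move: tam; rewrite /= !in_itv/= (ltW ct) => /andP[_ ->].
      by exists t => //; rewrite qal.
    rewrite -(qal t tcm) => /qE[<-|[_]].
      exists t => //; move: tcm; rewrite /= !in_itv/= => /andP[? ?].
      by apply/andP; split; lra.
    rewrite axE => -[t' + <-]; rewrite /= in_itv/= => /andP[? ?]; exists t' => //.
    by rewrite /= in_itv/=; apply/andP; split; lra.
  + rewrite axE => _ [t + <-]; rewrite /= in_itv/= => /andP[? ?]; exists t => //.
    by rewrite /= in_itv/=; apply/andP; split; lra.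
- by move=> i; rewrite -compA; exact: Q'pl.
- move=> i gm.
  have qg x : x \in `[0, 1] -> q (g i x) = g i x.
    apply: (qfix (Some i)) => /= {}x x01; rewrite bu => /gm -/(_ x01 (inI _ _)).
    by rewrite lexx am => /(_ isT); lra.
  move=> x x01 /=; rewrite -{2}(qg x x01); apply: (Q'fix i) => // y t y01 tcm /=.
  rewrite qg// => /gm; apply=> //.
  by move: tcm; rewrite !in_itv/= => /andP[? ?]; apply/andP; split; lra.
Qed.

End CollapseArc.

(** * Lifting directed cycles *)

(** At such an end a directed cycle can only leave, respectively enter, through [e]. *)
Definition free_end (G : digraph) (e : edge G) (x : vertex G) : Prop :=
  (x = src e /\ forall f, f != e -> src f != x) \/
  (x = tgt e /\ forall f, f != e -> tgt f != x).

Lemma path_sub_rel (T : eqType) (r r' : rel T) (h : T) (s : seq T) :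
  (forall f g, f \in belast h s -> g \in s -> r f g -> r' f g) ->
  path r h s -> path r' h s.
Proof.
elim: s h => //= k s IH h rr' /andP[hk ks]; apply/andP; split.
  by apply: rr' hk; rewrite mem_head.
by apply: IH ks => f g fb gs; apply: rr'; rewrite inE ?fb ?gs orbT.
Qed.

(** The targets are the sources rotated by one place. *)
Lemma directed_cycle_uniq_tgt (G : digraph) (c : seq (edge G)) :
  directed_cycle c -> uniq (map tgt c).
Proof.
case/and3P; case: c => // h s _ hs u.
suff -> : map tgt (h :: s) = rot 1 (map src (h :: s)) by rewrite rot_uniq.
move: hs; rewrite [cycle _ _]/= [map src _]/= rot1_cons -map_rcons => {u} hs.
elim: s {1 3}h hs => /= [|k s IH] h' /andP[/eqP -> //].
by move=> /IH /= [->].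
Qed.

Lemma directed_cycle_rot (G : digraph) (c : seq (edge G)) i :
  directed_cycle (rot i c) = directed_cycle c.
Proof.
by rewrite /directed_cycle rot_cycle map_rot rot_uniq -!size_eq0 size_rot.
Qed.

(** Consecutive edges of [c] lift to consecutive edges, except where the cycle passes from one end
    of [e] to the other. If it touches [x], this happens exactly once, next to the edge at [x], and
    [e] is inserted there. *)
Lemma lift_directed_cycle (G G' : digraph) (e : edge G') (x : vertex G')
    (pi : vertex G' -> vertex G) (iota : edge G -> edge G') :
  src e != tgt e -> free_end e x -> Defs.contraction e pi iota ->
  forall c, directed_cycle c -> exists c', [/\ directed_cycle c',
    forall f, (iota f \in c') = (f \in c),
    forall w, w \in map src c' -> pi w \in map src c &
    e \in c' \/ forall f, f \in c -> ~~ incident x (iota f)].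
Proof.
move=> est xfree [_ piE iotaI iotae piC] c dc.
have ie f : iota f != e by apply/iotae; exists f.
have pist : pi (src e) = pi (tgt e) by apply/eqP; rewrite piE !inE !eqxx orbT orbT.
have srcI f : src f = pi (src (iota f)) by rewrite (piC f).1.
have tgtI f : tgt f = pi (tgt (iota f)) by rewrite (piC f).2.
have memI (s : seq (edge G)) f : (iota f \in e :: map iota s) = (f \in s).
  by rewrite inE (negbTE (ie f)) mem_map.
have uniqI (s : seq (edge G)) : uniq (map src s) -> uniq (map src (map iota s)).
  move=> us; apply: (@map_uniq _ _ pi); rewrite -!map_comp.
  by rewrite (eq_map (g := src)).
have sub_src (s : seq (edge G)) w : w \in map src (map iota s) -> pi w \in map src s.
  rewrite -map_comp => /mapP[f fs ->].
  by apply/mapP; exists f => //=; rewrite srcI.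
have meet f g : tgt f == src g -> tgt (iota f) == src (iota g) \/
    (tgt (iota f) \in pred2 (src e) (tgt e) /\ src (iota g) \in pred2 (src e) (tgt e)).
  by rewrite srcI tgtI piE => /orP[->|/andP[]]; [left|right].
pose touches f := incident x (iota f).
have [/hasP[f0 f0c f0x]|/hasPn notouch] := boolP (has touches c); last first.
  exists (map iota c); split.
  - case/and3P: dc => c0 cyc uc; apply/and3P; split; last exact: uniqI.
      by rewrite -size_eq0 size_map size_eq0.
    rewrite cycle_map; apply: (sub_in_cycle (P := [in c])) cyc; last exact/allP.
    (* With [x] untouched, two lifts at ends of [e] are both at the other end. *)
    move=> f g fc gc /meet[//|[]]; have := notouch _ fc; have := notouch _ gc.
    rewrite /touches /incident !negb_or !inE => /andP[gx _] /andP[_ fx].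
    by case: xfree => [] [xE _]; move: gx fx; rewrite xE => /negbTE -> /negbTE ->;
      rewrite ?orbF /= => /eqP -> /eqP ->.
  - by move=> f; rewrite mem_map.
  - exact: sub_src.
  - by right.
have [i s rotc] := rot_to f0c.
have dc' : directed_cycle (f0 :: s) by rewrite -rotc directed_cycle_rot.
have memc f : (f \in f0 :: s) = (f \in c) by rewrite -rotc mem_rot.
have memc' w : (w \in map src (f0 :: s)) = (w \in map src c).
  by rewrite -rotc map_rot mem_rot.
have tgtu := directed_cycle_uniq_tgt dc'.
case/and3P: dc' => _ cyc srcu.
case: xfree => [] [xE xfree].
(* Here [x] is the tail of [e], so [f0] enters [x] and [e] goes right after it. *)
- have f0x' : tgt (iota f0) = x.
    by move: f0x; rewrite /touches /incident (negbTE (xfree _ (ie f0))) => /eqP.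
  have stgt f : f \in s -> tgt (iota f) != x.
    move=> fs; apply/eqP => fx; move: tgtu => /= /andP[/negP + _]; apply.
    by apply/mapP; exists f => //; rewrite !tgtI fx f0x'.
  have srce f : src (iota f) != src e by rewrite -xE; exact: xfree.
  have srceI (t : seq (edge G)) : src e \notin map src (map iota t).
    by rewrite -map_comp; apply/mapP => -[f _ fe]; move: (srce f); rewrite fe eqxx.
  (* The edge [h] is the successor of [f0] in the cycle, [f0] itself when [s] is empty. *)
  case Es : (rcons s f0) => [|h s']; first by case: (s) Es.
  move: cyc; rewrite [cycle _ _]/= Es /= => /andP[f0h hs'].
  have sE : belast h s' = s by move: Es; rewrite lastI => /rcons_inj[].
  have hsrc : src (iota h) = tgt e.
    have : src (iota h) \in pred2 (src e) (tgt e).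
      case: (meet _ _ f0h) => [|[]//]; rewrite f0x' xE => /eqP <-.
      by rewrite inE eqxx.
    by rewrite inE (negbTE (srce h)) => /eqP.
  exists (iota f0 :: e :: map iota s); split.
  + apply/and3P; split=> //=.
      rewrite f0x' xE eqxx/= -map_rcons Es /= hsrc eqxx/= path_map.
      apply: path_sub_rel hs' => f g; rewrite sE => /stgt fx _ /meet[//|[]].
      rewrite !inE -xE (negbTE fx) xE (negbTE (srce g)) /= => /eqP -> /eqP ->.
      by rewrite eqxx.
    by have /andP[un1 un2] := uniqI _ srcu; rewrite inE negb_or srce un1 srceI.
  + move=> f; rewrite -memc !inE (negbTE (ie f)) mem_map// (inj_eq iotaI).
    by rewrite orFb.
  + move=> w; rewrite -memc' => /=; rewrite !inE => /or3P[/eqP ->|/eqP ->|/sub_src ->].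
    * by rewrite -srcI eqxx.
    * rewrite pist -hsrc -srcI.
      have : h \in rcons s f0 by rewrite Es mem_head.
      rewrite mem_rcons inE => /orP[/eqP -> |hs]; first by rewrite eqxx.
      by rewrite map_f ?orbT.
    * by rewrite orbT.
  + by left; rewrite !inE eqxx orbT.
(* Dually, [f0] leaves [x] and [e] goes right before it. *)
- have f0x' : src (iota f0) = x.
    by move: f0x; rewrite /touches /incident (negbTE (xfree _ (ie f0))) orbF => /eqP.
  have ssrc f : f \in s -> src (iota f) != x.
    move=> fs; apply/eqP => fx; move: srcu => /= /andP[/negP + _]; apply.
    by apply/mapP; exists f => //; rewrite !srcI fx f0x'.
  have tgte f : tgt (iota f) != tgt e by rewrite -xE; exact: xfree.
  move: cyc; rewrite [cycle _ _]/= rcons_path => /andP[f0s lastf0].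
  exists (e :: map iota (f0 :: s)); split.
  + apply/and3P; split=> //=.
      rewrite f0x' xE eqxx/= rcons_path path_map last_map; apply/andP; split.
        apply: path_sub_rel f0s => f g _ /ssrc gx /meet[//|[]].
        rewrite !inE (negbTE (tgte f)) -xE (negbTE gx) !orbF /= => /eqP -> /eqP ->.
        by [].
      case: (meet _ _ lastf0) => [|[]]; first by rewrite f0x' xE (negbTE (tgte _)).
      by rewrite inE (negbTE (tgte _)) orbF.
    move: (uniqI _ srcu) => /= /andP[-> ->]; rewrite !andbT inE negb_or f0x' xE est/=.
    rewrite -map_comp; apply/mapP => -[f fs /= fe].
    move: srcu => /= /andP[/negP + _]; apply; apply/mapP; exists f => //.
    by rewrite !srcI f0x' xE -fe pist.
  + by move=> f; rewrite memI memc.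
  + move=> w; rewrite -memc' [map src (e :: _)]/= inE.
    move=> /orP[/eqP ->|ws]; last exact: (sub_src (f0 :: s)).
    by rewrite pist -xE -f0x' -srcI mem_head.
  + by left; rewrite mem_head.
Qed.

(** * Contracting an embedded edge *)

Lemma piecewise_linear_pl_arc (R : realType) (g : R -> 'rV[R]_3) :
  {within `[0, 1], continuous g} -> piecewise_linear g <-> pl_arc 0 1 g.
Proof.
move=> cg; split=> [[s ps /(affine_piecesP _ ps) pcs]|[_ gl]].
  by split=> //; exact: affine_pieces_locally_linear ps pcs.
have [s ps pcs] := locally_linear_affine_pieces ler01 gl.
by exists s => //; apply/(affine_piecesP _ ps).
Qed.

Lemma pl_arc_rev (R : realType) (g : R -> 'rV[R]_3) :
  pl_arc 0 1 g -> pl_arc 0 1 (fun t => g (1 - t)).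
Proof.
move=> [cg gl]; split.
  apply/subspace_continuousP => t t01.
  move/subspace_continuousP : cg => /(_ (1 - t)) cg.
  have t01' : `[0, 1]%classic (1 - t).
    by move: t01; rewrite /= !in_itv/= => /andP[? ?]; apply/andP; split; lra.
  apply: (@cvg_comp _ _ _ (fun t => 1 - t) g _ _ _ _ (cg t01')) => A At.
  have ct : 1 - s @[s --> t] --> 1 - t by apply: cvgB; [exact: cvg_cst|exact: cvg_id].
  have {}At : \forall s \near 1 - t, `[0, 1]%classic s -> A s := At.
  change (\forall s \near t, `[0, 1]%classic s -> A (1 - s)).
  near=> s => s01; have : `[0, 1]%classic (1 - s) -> A (1 - s).
    by near: s; exact: (ct _ At).
  by apply; move: s01; rewrite /= !in_itv/= => /andP[? ?]; apply/andP; split; lra.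
move=> s; split=> /andP[s0 s1].
  have [|b gb] := (gl (1 - s)).2; first by apply/andP; split; lra.
  by exists b; apply: filterS gb => h <-; congr g; ring.
have [|b gb] := (gl (1 - s)).1; first by apply/andP; split; lra.
by exists b; apply: filterS gb => h <-; congr g; ring.
Unshelve. all: by end_near. Qed.

Section EdgeArc.
Variables (R : realType) (G : digraph) (p : vertex G -> 'rV[R]_3).
Variable gamma : edge G -> R -> 'rV[R]_3.
Hypothesis emb : graph_embedding p gamma.

Lemma edge_end_cases (t : R) : t \in `[0, 1] -> [\/ t = 0, t = 1 | t \in `]0, 1[].
Proof.
rewrite !in_itv/= => /andP[]; rewrite !le_eqVlt.
move=> /predU1P[<-|t0]; first by constructor 1.
by move=> /predU1P[->|t1]; [constructor 2|constructor 3; rewrite t0].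
Qed.

Lemma edge_ends_meet (e f : edge G) (s t : R) : f != e ->
  s \in `[0, 1] -> t \in `[0, 1] -> gamma f s = gamma e t ->
  (s = 0 \/ s = 1) /\ (t = 0 \/ t = 1).
Proof.
have [_ _ ends inter intv] := emb.
move=> fe s01 t01 fset; have [s0|s1|sin] := edge_end_cases s01;
    have [t0|t1|tin] := edge_end_cases t01; try by auto.
- by have := intv e t (src f) tin; rewrite -fset s0 (ends f).1.
- by have := intv e t (tgt f) tin; rewrite -fset s1 (ends f).2.
- by have := intv f s (src e) sin; rewrite fset t0 (ends e).1.
- by have := intv f s (tgt e) sin; rewrite fset t1 (ends e).2.
- by have [fe' _] := inter _ _ _ _ sin tin fset; rewrite fe' eqxx in fe.
Qed.

Lemma edge_arc_inj (e : edge G) : src e != tgt e ->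
  {in `[0, 1] &, injective (gamma e)}.
Proof.
have [pinj _ ends inter intv] := emb.
move=> est s t s01 t01 fset; have [s0|s1|sin] := edge_end_cases s01;
    have [t0|t1|tin] := edge_end_cases t01.
- by rewrite s0.
- move: fset est; rewrite s0 t1 (ends e).1 (ends e).2 => /pinj ->.
  by rewrite eqxx.
- by have := intv e t (src e) tin; rewrite -fset s0 (ends e).1.
- move: fset est; rewrite s1 t0 (ends e).1 (ends e).2 => /pinj ->.
  by rewrite eqxx.
- by rewrite s1.
- by have := intv e t (tgt e) tin; rewrite -fset s1 (ends e).2.
- by have := intv e s (src e) sin; rewrite fset t0 (ends e).1.
- by have := intv e s (tgt e) sin; rewrite fset t1 (ends e).2.
- by have [] := inter _ _ _ _ sin tin fset.
Qed.

Lemma vertex_on_edge (e : edge G) (w : vertex G) :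
  (gamma e @` `[0, 1]) (p w) <-> w \in pred2 (src e) (tgt e).
Proof.
have [pinj _ ends inter intv] := emb.
rewrite !inE; split=> [[t t01 etw]|].
  have [t0|t1|tin] := edge_end_cases t01.
  - by move: etw; rewrite t0 (ends e).1 => /pinj ->; rewrite eqxx.
  - by move: etw; rewrite t1 (ends e).2 => /pinj ->; rewrite eqxx orbT.
  - by have := intv e t w tin etw.
move=> /orP[/eqP ->|/eqP ->].
  by exists 0; rewrite ?(ends e).1 //= in_itv/= lexx ler01.
by exists 1; rewrite ?(ends e).2 //= in_itv/= lexx ler01.
Qed.

End EdgeArc.

(** The map [h] straightens all arcs, and [collapse_arc] then shrinks the image of [e]; so arcs away
    from [x] are moved by [h] alone. *)
Lemma collapse_edge (R : realType) (G G' : digraph) (e : edge G') (x : vertex G')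
    (iota : edge G -> edge G') (p : vertex G' -> 'rV[R]_3)
    (gamma : edge G' -> R -> 'rV[R]_3) (h : 'rV[R]_3 -> 'rV[R]_3) :
  graph_embedding p gamma -> homeomorphism h ->
  (forall f, piecewise_linear (h \o gamma f)) ->
  src e != tgt e -> free_end e x -> (forall f, iota f != e) ->
  exists T, [/\ collapse T (gamma e @` `[0, 1]),
    forall f, piecewise_linear (T \o gamma (iota f)) &
    forall f, ~~ incident x (iota f) ->
      forall s, s \in `[0, 1] -> T (gamma (iota f) s) = h (gamma (iota f) s)].
Proof.
move=> emb hh hpl est xfree ie; have [pinj cgam ends inter intv] := emb.
have ch := collapse_homeomorphism hh; have [hcont _ _ _ _] := ch.
have [_ [k _ [hk _]]] := hh; have hinj := can_inj hk.
have chg f : {within `[0, 1], continuous (h \o gamma f)}.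
  by apply: within_continuous_comp (cgam f) => y _; exact: hcont.
have hga f : pl_arc 0 1 (h \o gamma f) by apply/piecewise_linear_pl_arc.
(* The reparametrization [rv] makes the arc of [e] start at [x]: it is the identity or t -> 1 -
   t. *)
have [rv [rv01 rvK rv0 rvend plrv]] : exists rv : R -> R, [/\
    forall t, t \in `[0, 1] -> rv t \in `[0, 1], involutive rv,
    gamma e (rv 0) = p x, forall t, rv t = 0 \/ rv t = 1 -> t = 0 \/ t = 1 &
    pl_arc 0 1 (h \o gamma e \o rv)].
  case: xfree => [] [-> _].
    by exists id; split=> //; [exact: (ends e).1|exact: hga].
  exists (fun t => 1 - t); split.
  - by move=> t; rewrite !in_itv/= => /andP[? ?]; apply/andP; split; lra.
  - by move=> t; ring.
  - by rewrite subr0 (ends e).2.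
  - by move=> t [?|?]; [right|left]; lra.
  - exact: pl_arc_rev.
pose alpha := h \o gamma e \o rv; have [calpha lalpha] := plrv.
have [s ps pcs] := locally_linear_affine_pieces ler01 lalpha.
have ialpha : {in `[0, 1] &, injective alpha}.
  move=> s1 t1 s01 t01 /hinj /(edge_arc_inj emb est) rvE.
  by apply: (can_inj rvK); apply: rvE; exact: rv01.
have imE : alpha @` `[0, 1] = h @` (gamma e @` `[0, 1]).
  apply/seteqP; split=> [_ [t t01 <-]|_ [_ [t t01 <-] <-]].
    by exists (gamma e (rv t)) => //; exists (rv t) => //; exact: rv01.
  by exists (rv t); [exact: rv01|rewrite /alpha /= rvK].
have meet f r t : r \in `[0, 1] -> t \in `[0, 1] -> h (gamma (iota f) r) = alpha t ->
    (r = 0 \/ r = 1) /\ (t = 0 \/ t = 1).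
  move=> r01 t01 /hinj /(edge_ends_meet emb (ie f) r01 (rv01 _ t01)) [? /rvend]; by [].
have [|Q [cQ Qpl Qfix]] := collapse_arc ps pcs calpha ialpha
    (fun f => hga (iota f)).
  by move=> f r t r01 t01 /(meet f r t r01 t01) [].
have cT : collapse (Q \o h) (gamma e @` `[0, 1]).
  apply: (collapse_comp ch cQ) => //.
    apply: connected_continuous_connected (cgam e).
    by apply/connected_intervalP; exact: interval_is_interval.
  rewrite imE; apply/seteqP; split=> [y ye|y [z ze /hinj <-]] //.
  by exists y.
exists (Q \o h); split=> // f.
  have [cTg lTg] := Qpl f.
  exact/(piecewise_linear_pl_arc cTg).
move=> fx; apply: (Qfix f) => r t r01 t01 fal.
have [rend [t0|//]] := meet f r t r01 t01 fal.
move: fal fx; rewrite t0 /alpha /= rv0 => /hinj.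
by case: rend => ->; rewrite ?(ends _).1 ?(ends _).2 => /pinj xE;
  rewrite /incident xE eqxx ?orbT.
Qed.

Lemma consistent_edge_free_end (G : digraph) (e : edge G) :
  consistent_edge e -> src e != tgt e /\ exists x, free_end e x.
Proof.
by move=> [est [xe|xe]]; split=> //; [exists (src e); left|exists (tgt e); right].
Qed.

Section ContractedEmbedding.
Variables (R : realType) (G G' : digraph) (e : edge G').
Variables (pi : vertex G' -> vertex G) (iota : edge G -> edge G').
Variables (p : vertex G' -> 'rV[R]_3) (gamma : edge G' -> R -> 'rV[R]_3).
Variable T : 'rV[R]_3 -> 'rV[R]_3.
Hypothesis emb : graph_embedding p gamma.
Hypothesis contr : Defs.contraction e pi iota.
Hypothesis clps : collapse T (gamma e @` `[0, 1]).

Lemma contraction_iota_neq f : iota f != e.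
Proof. by have [_ _ _ iotae _] := contr; apply/iotae; exists f. Qed.

Lemma collapse_vertex w w' : T (p w) = T (p w') <-> pi w = pi w'.
Proof.
have [pinj _ _ _ _] := emb; have [_ piE _ _ _] := contr.
have [_ _ _ _ TE] := clps.
rewrite TE !(vertex_on_edge emb); split.
  move=> [/pinj -> //|[we w'e]]; apply/eqP.
  by rewrite piE we w'e orbT.
by move/eqP; rewrite piE => /orP[/eqP ->|/andP[]]; [left|right].
Qed.

Lemma contracted_embedding (pG : vertex G -> 'rV[R]_3) :
  (forall w, pG (pi w) = T (p w)) ->
  graph_embedding pG (fun f => T \o gamma (iota f)).
Proof.
move=> pGE; have [pinj cgam ends inter intv] := emb.
have [pisurj piE iotaI iotae piC] := contr.
have [cT _ _ _ TE] := clps.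
(* Interior points of the other arcs lie off the arc of [e], so [T] identifies them with no other
   point. *)
have interior f (s : R) : s \in `]0, 1[ -> ~ (gamma e @` `[0, 1]) (gamma (iota f) s).
  move=> s01 [t t01] /esym/(edge_ends_meet emb (contraction_iota_neq f)) [||+ _] //.
    by move: s01; rewrite !in_itv/= => /andP[/ltW -> /ltW ->].
  by move: s01; rewrite in_itv/= => /andP[s0 s1] [] sE; move: s0 s1; rewrite sE ltxx.
split.
- move=> v v'; have [w <-] := pisurj v; have [w' <-] := pisurj v'.
  by rewrite !pGE => /collapse_vertex.
- by move=> f; apply: within_continuous_comp (cgam _) => y _; exact: cT.
- move=> f; rewrite -(piC f).1 -(piC f).2 !pGE /=.
  by rewrite (ends _).1 (ends _).2.
- move=> f f' s t s01 t01 /= /TE[|[/interior]//].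
  by move=> /inter[]// /iotaI.
- move=> f s v s01; have [w <-] := pisurj v.
  by rewrite pGE /= => /TE[/intv|[/interior]]; exact.
Qed.

Lemma collapse_cycle_image (c : seq (edge G)) (c' : seq (edge G')) :
  (forall f, (iota f \in c') = (f \in c)) ->
  (forall w, w \in map src c' -> pi w \in map src c) ->
  T @` cycle_image gamma c' = cycle_image (fun f => T \o gamma (iota f)) c.
Proof.
move=> cc' srcc'; have [_ _ ends _ _] := emb.
have [_ _ _ iotae piC] := contr; have [_ _ _ _ TE] := clps.
apply/seteqP; split=> [_ [z [f' f'c' fz] <-]|_ [f fc [t t01 <-]]].
  have [f'e|/iotae[f ff']] := eqVneq f' e; last first.
    move: f'c' fz; rewrite -ff' cc' => fc [t t01 tz].
    by exists f => //; exists t; rewrite //= tz.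
  (* The arc of [e] becomes a single point, which is the image of the starting point of an edge [f]
     of [c]. *)
  have : pi (src e) \in map src c by apply: srcc'; rewrite map_f// -f'e.
  move=> /mapP[f fc fe]; exists f => //; exists 0; first by rewrite /= in_itv/= lexx ler01.
  rewrite /= (ends _).1; apply/TE; right; split; last by rewrite -f'e.
  apply/(vertex_on_edge emb).
  have [_ piE _ _ _] := contr.
  have /eqP : pi (src (iota f)) = pi (src e) by rewrite (piC f).1.
  by rewrite piE => /orP[/eqP ->|/andP[]//]; rewrite inE eqxx.
exists (gamma (iota f) t) => //; exists (iota f); first by rewrite cc'.
by exists t.
Qed.

End ContractedEmbedding.

Lemma linkless_contraction (R : realType) (G G' : digraph) :
  consistent_edge_contraction G' G ->
  has_linkless_embedding R G' -> has_linkless_embedding R G.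
Proof.
move=> [e [pi [iota [/consistent_edge_free_end[est [x xfree]] contr]]]].
move=> [p [gamma [[emb [h hh hpl]] nolink]]].
have ie := contraction_iota_neq contr.
have [T [clps Tpl Tfix]] := collapse_edge emb hh hpl est xfree ie.
have [pisurj _ _ _ _] := contr.
(* Any choice of preimages serves to place the vertices, since [T] sends both ends of [e] to the
   same point. *)
have [pinv pinvK] := choice pisurj.
exists (T \o p \o pinv), (fun f => T \o gamma (iota f)).
split.
  split.
    apply: (contracted_embedding emb contr clps) => w /=.
    by apply/(collapse_vertex emb contr clps); rewrite pinvK.
  (* The new arcs are already piecewise linear, so the identity straightens them. *)
  exists id; last by [].
  split; first by move=> y; exact: cvg_id.
  by exists id => // y; exact: cvg_id.
move=> [n [c [n2 cyc disj nsplit]]]; apply: nolink.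
have /choice[c' c'P] := fun i => lift_directed_cycle est xfree contr (cyc i).
exists n, c'; split=> //.
- by move=> i; have [] := c'P i.
- move=> i j /disj ij; rewrite /disjoint_cycles; apply/pred0P => w /=.
  apply/negP => /andP[wi wj].
  have [_ _ /(_ w wi) pwi _] := c'P i; have [_ _ /(_ w wj) pwj _] := c'P j.
  by move/pred0P: ij => /(_ (pi w)) /=; rewrite pwi pwj.
move=> split'; apply: nsplit.
have [[i0 ei0]|noe] := pselect (exists i, e \in c' i).
  have -> : (fun i => cycle_image (fun f => T \o gamma (iota f)) (c i)) =
            (fun i => T @` cycle_image gamma (c' i)).
    apply/funext => i; have [_ memi srci _] := c'P i.
    by rewrite (collapse_cycle_image emb contr clps memi srci).
  apply: split_collapse clps _ split' => y ey.
  by exists i0 => //; exists e.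
(* Now the sphere may cross the arc of [e], so [T] could fail to be injective on it. On the lifted
   cycles [T] agrees with [h], which carries the sphere over. *)
have -> : (fun i => cycle_image (fun f => T \o gamma (iota f)) (c i)) =
          (fun i => h @` cycle_image gamma (c' i)).
  apply/funext => i; have [_ memi _ [eci|notouch]] := c'P i.
    by case: noe; exists i.
  have [_ _ _ iotae _] := contr.
  apply/seteqP; split=> [_ [f fc [t t01 <-]]|_ [_ [f' f'c [t t01 <-]] <-]].
    exists (gamma (iota f) t); last by rewrite /= Tfix// notouch.
    by exists (iota f); [rewrite memi|exists t].
  have /iotae[f ff'] : f' != e by apply/eqP => f'e; apply: noe; exists i; rewrite -f'e.
  move: f'c; rewrite -ff' memi => fc; exists f => //; exists t => //.
  by rewrite /= Tfix// notouch.
by apply: split_collapse (collapse_homeomorphism hh) _ split'.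
Qed.

Theorem proposition2p2 (R : realType) (G G' : digraph) :
  (consistent_vertex_expansion G G' ->
     intrinsically_linked R G -> intrinsically_linked R G') /\
  (consistent_edge_contraction G' G ->
     has_linkless_embedding R G' -> has_linkless_embedding R G).
Proof.
(* Contracting the new edge undoes an expansion, so the first half is the contrapositive of the
   second. *)
split; last exact: linkless_contraction.
move=> [v [v1 [v2 [e [pi [iota [[_ contr _] econs]]]]]]] linkedG p gamma tame.
apply: contrapT => nolink.
have [||q [delta [tameG]]] := @linkless_contraction R G G'.
- by exists e, pi, iota.
- by exists p, gamma.
- by apply; exact: linkedG tameG.
Qed.
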